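(* Let $A$ be a Hopf algebra with antipode $S_A$, and let $\Omega(A)=(H,\triangleleft,\triangleright,f)$ with multiplication $\cdot$ on $H$ and $\Omega'(A)=(H,\triangleleft',\triangleright',f')$ with multiplication $\cdot'$ on $H$ be two Hopf algebra extending structures of $A$ having the same underlying coalgebra $H$ and the same unit $1_H$. Then there exists a $k$-linear map $\varphi:A\ltimes' H\to A\ltimes H$ which is simultaneously a left $A$-module map, a right $H$-comodule map and a Hopf algebra map if and only if $\triangleleft'=\triangleleft$ and there exists a coalgebra lazy $1$-cocycle $u\in H^1_{l,c}(H,A)$ such that for all $h,g\in H$, $c\in A$: (i) $h\triangleright' c=u(h_{(1)})\,(h_{(2)}\triangleright c_{(1)})\,S_A\bigl(u(h_{(3)}\triangleleft c_{(2)})\bigr)$; (ii) $f'(h,g)=u(h_{(1)})\,\bigl(h_{(2)}\triangleright u(g_{(1)})\bigr)\,f\bigl(h_{(3)}\triangleleft u(g_{(2)}),\,g_{(3)}\bigr)\,S_A\bigl(u(h_{(4)}\cdot' g_{(4)})\bigr)$; (iii) $h\cdot' g=\bigl(h\triangleleft u(g_{(1)})\bigr)\cdot g_{(2)}$. In this case $\varphi(a\ltimes' h)=a\,u(h_{(1)})\ltimes h_{(2)}$ and $\varphi$ is an isomorphism.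
   Context: $k$ is a field; Sweedler notation. An extending datum of a bialgebra $A$ is a system $(H,\triangleleft,\triangleright,f)$ where $H$ is a coalgebra $(\Delta_H,\varepsilon_H)$ with a unital, not necessarily associative multiplication $\cdot$ and unit $1_H$ with $\Delta_H(1_H)=1_H\otimes 1_H$, and $\triangleleft:H\otimes A\to H$, $\triangleright:H\otimes A\to A$, $f:H\otimes H\to A$ are coalgebra maps satisfying $h\triangleright 1_A=\varepsilon_H(h)1_A$, $1_H\triangleright a=a$, $1_H\triangleleft a=\varepsilon_A(a)1_H$, $h\triangleleft 1_A=h$, $f(h,1_H)=f(1_H,h)=\varepsilon_H(h)1_A$. The unified product $A\ltimes H$ is $A\otimes H$ (elements written $a\ltimes h$) with multiplication $(a\ltimes h)\bullet(c\ltimes g)=a(h_{(1)}\triangleright c_{(1)})f(h_{(2)}\triangleleft c_{(2)},g_{(1)})\ltimes(h_{(3)}\triangleleft c_{(3)})\cdot g_{(2)}$, unit $1_A\ltimes 1_H$ and tensor product coalgebra structure; the datum is a Hopf algebra extending structure if $A\ltimes H$ is then a Hopf algebra. $A\ltimes' H$ is built in the same way from $\Omega'(A)$ and $\cdot'$. Each unified product is a left $A$-module via $b\cdot(a\ltimes h)=ba\ltimes h$ and a right $H$-comodule via $a\ltimes h\mapsto a\ltimes h_{(1)}\otimes h_{(2)}$. A coalgebra lazy $1$-cocycle is a coalgebra map $u:H\to A$ with $u(1_H)=1_A$ and $h_{(1)}\otimes u(h_{(2)})=h_{(2)}\otimes u(h_{(1)})$ for all $h\in H$; $H^1_{l,c}(H,A)$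 is the set of these. *)

(* Defs.v *)
(* Tensor products are modelled by formal sums
   (sequences of pure tensors); two formal sums are equal in the tensor
   product iff they have the same image under every multilinear map into
   every k-vector space (universal property of the tensor product).
   A map out of a tensor product V (x) W is modelled by a bilinear map
   V -> W -> _, and Sweedler notation by sums over the chosen
   representative D x of the comultiplication. *)
From HB Require Import structures.
From mathcomp Require Import all_boot all_order all_algebra.
Set Implicit Arguments. Unset Strict Implicit. Unset Printing Implicit Defensive.
Import GRing.Theory.
Local Open Scope ring_scope.

Section Tensors.
Variable k : fieldType.

Definition bilin (V W X : lmodType k) (b : V -> W -> X) : Prop :=
  (forall (a : k) v v' w, b (a *: v + v') w = a *: b v w + b v' w) /\
  (forall (a : k) v w w', b v (a *: w + w') = a *: b v w + b v w').

Definition trilin (U V W X : lmodType k) (b : U -> V -> W -> X) : Prop :=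
  [/\ (forall (a : k) x x' y z, b (a *: x + x') y z = a *: b x y z + b x' y z),
      (forall (a : k) x y y' z, b x (a *: y + y') z = a *: b x y z + b x y' z) &
      (forall (a : k) x y z z', b x y (a *: z + z') = a *: b x y z + b x y z')].

Definition quadlin (U V W Y X : lmodType k) (b : U -> V -> W -> Y -> X) : Prop :=
  [/\ (forall (a : k) x x' y z t, b (a *: x + x') y z t = a *: b x y z t + b x' y z t),
      (forall (a : k) x y y' z t, b x (a *: y + y') z t = a *: b x y z t + b x y' z t),
      (forall (a : k) x y z z' t, b x y (a *: z + z') t = a *: b x y z t + b x y z' t) &
      (forall (a : k) x y z t t', b x y z (a *: t + t') = a *: b x y z t + b x y z t')].

Definition teq2 (V W : lmodType k) (s t : seq (V * W)) : Prop :=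
  forall (X : lmodType k) (b : V -> W -> X), bilin b ->
    \sum_(p <- s) b p.1 p.2 = \sum_(p <- t) b p.1 p.2.

Definition teq3 (U V W : lmodType k) (s t : seq (U * V * W)) : Prop :=
  forall (X : lmodType k) (b : U -> V -> W -> X), trilin b ->
    \sum_(p <- s) b p.1.1 p.1.2 p.2 = \sum_(p <- t) b p.1.1 p.1.2 p.2.

Definition teq4 (U V W Y : lmodType k) (s t : seq ((U * V) * (W * Y))) : Prop :=
  forall (X : lmodType k) (b : U -> V -> W -> Y -> X), quadlin b ->
    \sum_(p <- s) b p.1.1 p.1.2 p.2.1 p.2.2 = \sum_(p <- t) b p.1.1 p.1.2 p.2.1 p.2.2.

Definition tscale (V W : lmodType k) (a : k) (s : seq (V * W)) : seq (V * W) :=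
  [seq (a *: p.1, p.2) | p <- s].

(* F : V -> W -> (formal sums in Z1 (x) Z2) represents a k-linear map
   V (x) W -> Z1 (x) Z2 *)
Definition bilin_into (V W Z1 Z2 : lmodType k) (F : V -> W -> seq (Z1 * Z2)) : Prop :=
  (forall (a : k) v v' w, teq2 (F (a *: v + v') w) (tscale a (F v w) ++ F v' w)) /\
  (forall (a : k) v w w', teq2 (F v (a *: w + w')) (tscale a (F v w) ++ F v w')).

Definition applyT (V W Z1 Z2 : Type) (F : V -> W -> seq (Z1 * Z2)) (s : seq (V * W))
  : seq (Z1 * Z2) := flatten [seq F p.1 p.2 | p <- s].

Definition delta3 (V : Type) (D : V -> seq (V * V)) (v : V) : seq (V * V * V) :=
  [seq (p.1, q.1, q.2) | p <- D v, q <- D p.2].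

Definition delta4 (V : Type) (D : V -> seq (V * V)) (v : V) : seq (V * V * V * V) :=
  flatten [seq [seq (p.1, q.1, r.1, r.2) | r <- D q.2] | p <- D v, q <- D p.2].

Definition coalgebra (C : lmodType k) (D : C -> seq (C * C)) (e : C -> k) : Prop :=
  [/\ (forall (a : k) x y, teq2 (D (a *: x + y)) (tscale a (D x) ++ D y)),
      (forall (a : k) x y, e (a *: x + y) = a * e x + e y),
      (forall x, teq3 [seq (p.1, q.1, q.2) | p <- D x, q <- D p.2]
                      [seq (q.1, q.2, p.2) | p <- D x, q <- D p.1]),
      (forall x, \sum_(p <- D x) e p.1 *: p.2 = x) &
      (forall x, \sum_(p <- D x) e p.2 *: p.1 = x)].

Definition hopf_algebra (A : algType k) (D : A -> seq (A * A)) (e : A -> k)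
  (S : A -> A) : Prop :=
  [/\ coalgebra D e,
      (forall a b, teq2 (D (a * b)) [seq (p.1 * q.1, p.2 * q.2) | p <- D a, q <- D b])
        /\ teq2 (D 1) [:: (1, 1)],
      (forall a b, e (a * b) = e a * e b) /\ e 1 = 1,
      (forall (c : k) x y, S (c *: x + y) = c *: S x + S y) &
      (forall a, \sum_(p <- D a) S p.1 * p.2 = e a *: 1
              /\ \sum_(p <- D a) p.1 * S p.2 = e a *: 1)].

(* t : V (x) W -> C (given as a bilinear map) is a coalgebra map, where
   V (x) W carries the tensor product coalgebra structure *)
Definition coalg_map2 (V W C : lmodType k)
  (DV : V -> seq (V * V)) (eV : V -> k) (DW : W -> seq (W * W)) (eW : W -> k)
  (DC : C -> seq (C * C)) (eC : C -> k) (t : V -> W -> C) : Prop :=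
  [/\ bilin t,
      (forall v w, teq2 (DC (t v w)) [seq (t p.1 q.1, t p.2 q.2) | p <- DV v, q <- DW w]) &
      (forall v w, eC (t v w) = eV v * eW w)].

Section Unified.
Variables (A : algType k) (DA : A -> seq (A * A)) (eA : A -> k).
Variables (H : lmodType k) (DH : H -> seq (H * H)) (eH : H -> k) (oneH : H).

Definition extending_datum (m : H -> H -> H) (lt : H -> A -> H) (rt : H -> A -> A)
  (f : H -> H -> A) : Prop :=
  [/\ coalgebra DH eH,
      bilin m /\ (forall h, m oneH h = h /\ m h oneH = h),
      teq2 (DH oneH) [:: (oneH, oneH)],
      [/\ coalg_map2 DH eH DA eA DH eH lt, coalg_map2 DH eH DA eA DA eA rt &
          coalg_map2 DH eH DH eH DA eA f] &
      [/\ (forall h, rt h 1 = eH h *: 1), (forall a, rt oneH a = a),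
          (forall a, lt oneH a = eA a *: oneH), (forall h, lt h 1 = h) &
          (forall h, f h oneH = eH h *: 1 /\ f oneH h = eH h *: 1)]].

(* multiplication of the unified product on pure tensors:
   (a >< h)(c >< g) = a (h1 |> c1) f(h2 <| c2, g1) >< (h3 <| c3) . g2 *)
Definition umul (m : H -> H -> H) (lt : H -> A -> H) (rt : H -> A -> A)
  (f : H -> H -> A) (a : A) (h : H) (c : A) (g : H) : seq (A * H) :=
  flatten [seq [seq (a * rt x.1.1 y.1.1 * f (lt x.1.2 y.1.2) z.1, m (lt x.2 y.2) z.2)
               | z <- DH g] | x <- delta3 DH h, y <- delta3 DA c].

Definition mulT (mul : A -> H -> A -> H -> seq (A * H)) (s t : seq (A * H)) : seq (A * H) :=
  flatten [seq mul p.1 p.2 q.1 q.2 | p <- s, q <- t].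

Definition DT (s : seq (A * H)) : seq ((A * H) * (A * H)) :=
  flatten [seq [seq ((x.1, y.1), (x.2, y.2)) | y <- DH p.2] | p <- s, x <- DA p.1].

Definition epsT (s : seq (A * H)) : k := \sum_(p <- s) eA p.1 * eH p.2.

Definition unified_is_hopf (mul : A -> H -> A -> H -> seq (A * H)) : Prop :=
  let one := (1 : A, oneH) in
  let mT := mulT mul in
  [/\ (forall x y z : A * H, teq2 (mT (mT [:: x] [:: y]) [:: z]) (mT [:: x] (mT [:: y] [:: z]))),
      (forall x : A * H, teq2 (mT [:: one] [:: x]) [:: x] /\ teq2 (mT [:: x] [:: one]) [:: x]),
      (forall x y : A * H,
         teq4 (DT (mT [:: x] [:: y]))
              (flatten [seq [seq (r, s) | r <- mT [:: p.1] [:: q.1], s <- mT [:: p.2] [:: q.2]]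
                       | p <- DT [:: x], q <- DT [:: y]]))
        /\ teq4 (DT [:: one]) [:: (one, one)],
      (forall x y : A * H, epsT (mT [:: x] [:: y]) = epsT [:: x] * epsT [:: y])
        /\ epsT [:: one] = 1 &
      (exists S : A -> H -> seq (A * H), bilin_into S /\
         forall x : A * H,
           teq2 (flatten [seq mT (S p.1.1 p.1.2) [:: p.2] | p <- DT [:: x]])
                (tscale (epsT [:: x]) [:: one])
        /\ teq2 (flatten [seq mT [:: p.1] (S p.2.1 p.2.2) | p <- DT [:: x]])
                (tscale (epsT [:: x]) [:: one]))].

Definition hopf_ext_struct (m : H -> H -> H) (lt : H -> A -> H) (rt : H -> A -> A)
  (f : H -> H -> A) : Prop :=
  extending_datum m lt rt f /\ unified_is_hopf (umul m lt rt f).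

(* Phi : A >< H (built from mul') -> A >< H (built from mul) is a k-linear map
   which is a left A-module map, a right H-comodule map and a Hopf algebra
   (= bialgebra) map *)
Definition ext_morphism (mul' mul : A -> H -> A -> H -> seq (A * H))
  (Phi : A -> H -> seq (A * H)) : Prop :=
  [/\ bilin_into Phi,
      (forall b a h, teq2 (Phi (b * a) h) [seq (b * p.1, p.2) | p <- Phi a h]),
      (forall a h, teq3 [seq (q.1, q.2, p.2) | p <- DH h, q <- Phi a p.1]
                        [seq (q.1, r.1, r.2) | q <- Phi a h, r <- DH q.2]),
      (forall a h c g, teq2 (applyT Phi (mulT mul' [:: (a, h)] [:: (c, g)]))
                            (mulT mul (Phi a h) (Phi c g)))
        /\ teq2 (Phi 1 oneH) [:: (1, oneH)] &
      (forall a h, teq4 (DT (Phi a h))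
                        (flatten [seq [seq (x, y) | x <- Phi p.1.1 p.1.2, y <- Phi p.2.1 p.2.2]
                                 | p <- DT [:: (a, h)]]))
        /\ (forall a h, epsT (Phi a h) = eA a * eH h)].

Definition lin_bijective (Phi : A -> H -> seq (A * H)) : Prop :=
  exists Psi : A -> H -> seq (A * H), bilin_into Psi /\
    forall a h, teq2 (applyT Phi (Psi a h)) [:: (a, h)] /\
                teq2 (applyT Psi (Phi a h)) [:: (a, h)].

Definition lazy_cocycle (u : H -> A) : Prop :=
  [/\ (forall (c : k) x y, u (c *: x + y) = c *: u x + u y),
      (forall h, teq2 (DA (u h)) [seq (u p.1, u p.2) | p <- DH h]),
      (forall h, eA (u h) = eH h),
      u oneH = 1 &
      (forall h, teq2 [seq (p.1, u p.2) | p <- DH h] [seq (p.2, u p.1) | p <- DH h])].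

Definition phi_of (u : H -> A) (a : A) (h : H) : seq (A * H) :=
  [seq (a * u p.1, p.2) | p <- DH h].

End Unified.
End Tensors.

(* Main.v *)
(* Applying the counit of H to the middle leg of the comodule condition shows
   that Phi (a >< h) = a u(h1) >< h2 with u(h) = (id (x) eH)(Phi (1 >< h)).
   Comultiplicativity of such a map then amounts to u being a coalgebra map
   satisfying the lazy condition.  By associativity and A-linearity,
   multiplicativity has to be tested only on (1 >< h)(c >< 1) and on
   (1 >< h)(1 >< g).  In each case the identity reads
     sum b ((F * uv)(x1)) (v x2) = sum b (Q x1) (w x2)
   over the coalgebra H (x) A, resp. H (x) H, where F is rt', resp. f', v is lt',
   resp. m', and * is convolution; applying the two counits splits it into v = w
   and F * uv = Q, and since SA u is the convolution inverse of u, the latter is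
   F = Q * (SA u v), that is, condition (i), resp. (ii). *)

(* Equality in a tensor product is tested by multilinear maps, so identities between Sweedler sums
   are proved for an arbitrary test map [b], and each use of coassociativity or of a counit owes a
   proof of multilinearity; [mlin] supplies these. Two points go beyond convolution. The product
   [(1 >< h)(1 >< g)] fits the common pattern only if [m'] is a coalgebra map; the datum does not
   list this, and it is extracted from the bialgebra structure of the unified product by applying
   [eA] to the [A]-legs. Moreover the lazy condition also serves multiplicativity:
   [phi (1 >< h) phi (1 >< g)] uses five legs of [g], with [u(g1), u(g2), g4] in the [A]-component
   and [u(g3), g5] in the [H]-component, and it splits as [Q (x) w] only after legs 3 and 4 are
   exchanged. *)
Require Import Defs.
From mathcomp Require Import all_boot all_order all_algebra.
Import GRing.Theory.
Local Open Scope ring_scope.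
Set Implicit Arguments. Unset Strict Implicit. Unset Printing Implicit Defensive.

(* For [s = D h] this is the Sweedler sum of [b h_(1) h_(2)]. *)
Definition ev (k : fieldType) (V W : Type) (X : lmodType k) (b : V -> W -> X)
    (s : seq (V * W)) : X :=
  \sum_(p <- s) b p.1 p.2.

Notation "\sw_ ( x , y <- s ) E" := (ev (fun x y => E) s)
  (at level 36, E at level 36, x name, y name, s at level 50,
   format "'[' \sw_ ( x ,  y  <-  s ) '/  '  E ']'").

(** * Evaluating maps on formal sums of pure tensors *)

Section FormalSums.
Context (k : fieldType).

Lemma eq_ev (V W : Type) (X : lmodType k) (b c : V -> W -> X) s :
  (forall x y, b x y = c x y) -> ev b s = ev c s.
Proof. by move=> e; apply: eq_bigr => p _; apply: e. Qed.

Lemma ev_cat (V W : Type) (X : lmodType k) (b : V -> W -> X) s t :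
  ev b (s ++ t) = ev b s + ev b t.
Proof. exact: big_cat. Qed.

Lemma ev_seq1 (V W : Type) (X : lmodType k) (b : V -> W -> X) x y :
  ev b [:: (x, y)] = b x y.
Proof. exact: big_seq1. Qed.

Lemma ev_map (V W V' W' : Type) (X : lmodType k) (b : V -> W -> X)
    (g : V' -> W' -> V) (h : V' -> W' -> W) s :
  ev b [seq (g p.1 p.2, h p.1 p.2) | p <- s] = \sw_(x, y <- s) b (g x y) (h x y).
Proof. exact: big_map. Qed.

Lemma exchange_ev (V W V' W' : Type) (X : lmodType k) (F : V -> W -> V' -> W' -> X) s t :
  \sw_(x, y <- s) \sw_(z, w <- t) F x y z w =
  \sw_(z, w <- t) \sw_(x, y <- s) F x y z w.
Proof. exact: exchange_big. Qed.

Lemma sum_delta3 (V : Type) (X : lmodType k) (D : V -> seq (V * V)) (F : V * V * V -> X) v :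
  \sum_(x <- delta3 D v) F x = \sw_(p, q <- D v) \sw_(r, s <- D q) F (p, r, s).
Proof. exact: big_allpairs_dep. Qed.

Lemma sum_delta4 (V : Type) (X : lmodType k) (D : V -> seq (V * V)) (F : V * V * V * V -> X) v :
  \sum_(x <- delta4 D v) F x =
  \sw_(p, q <- D v) \sw_(r, s <- D q) \sw_(t, w <- D s) F (p, r, t, w).
Proof.
rewrite /delta4 big_flatten big_allpairs_dep; apply: eq_bigr => p _; apply: eq_bigr => q _.
exact: big_map.
Qed.

End FormalSums.

(** * Closure properties of linear and multilinear maps *)

Section Multilinear.
Context (k : fieldType).
Implicit Types U V W X Y Z : lmodType k.

Lemma linear_id V : linear (fun x : V => x).
Proof. by []. Qed.

Lemma linear_comp V W X (g : W -> X) (E : V -> W) :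
  linear g -> linear E -> linear (fun x => g (E x)).
Proof. by move=> lg lE a x y; rewrite lE lg. Qed.

Lemma linear_ev V X (T U : Type) (F : V -> T -> U -> X) s :
  (forall p q, linear (fun x => F x p q)) -> linear (fun x => ev (F x) s).
Proof.
move=> lF a x y; rewrite /ev scaler_sumr -big_split.
by apply: eq_bigr => p _; apply: lF.
Qed.

(** A comultiplication is not linear as a function into sequences, only after evaluation against
    bilinear maps; its linearity therefore enters as a property of [ev b]. *)
Lemma linear_sw V W X Y Z (D : W -> seq (X * Y)) (F : X -> Y -> Z) (E : V -> W) :
  (forall b : X -> Y -> Z, bilin b -> linear (fun w => ev b (D w))) ->
  bilin F -> linear E -> linear (fun x => ev F (D (E x))).
Proof. by move=> lD lF lE; apply: (linear_comp (lD F lF) lE). Qed.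

Lemma linear_out V W (T U : Type) (g : V -> W) (F : T -> U -> V) s :
  linear g -> g (ev F s) = \sw_(p, q <- s) g (F p q).
Proof.
(* Linearity at the scalar -1 reads [g (-1 *: 0 + 0) = - g 0 + g 0]. *)
move=> lg; have g0 : g 0 = 0 by have := lg (-1) 0 0; rewrite scaler0 addr0 scaleN1r addNr.
rewrite /ev; elim: s => [|p s IH]; first by rewrite !big_nil.
by rewrite !big_cons -[F _ _]scale1r lg IH !scale1r.
Qed.

Lemma linear_scale V W (g : V -> W) : linear g -> forall a x, g (a *: x) = a *: g x.
Proof.
move=> lg a x; have g0 : g 0 = 0 by have := lg (-1) 0 0; rewrite scaler0 addr0 scaleN1r addNr.
by rewrite -[a *: x]addr0 lg g0 addr0.
Qed.

Lemma linear_scalel V W (E : V -> k) (w : W) :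
  linear (E : V -> k^o) -> linear (fun x => E x *: w).
Proof. by move=> lE a x y; rewrite lE scalerDl scalerA. Qed.

Lemma linear_scaler V W (c : k) (E : V -> W) : linear E -> linear (fun x => c *: E x).
Proof. by move=> lE a x y; rewrite lE scalerDr !scalerA mulrC. Qed.

Lemma linear_mull V (A : algType k) (E : V -> A) (c : A) :
  linear E -> linear (fun x => E x * c).
Proof. by move=> lE a x y; rewrite lE mulrDl scalerAl. Qed.

Lemma linear_mulr V (A : algType k) (E : V -> A) (c : A) :
  linear E -> linear (fun x => c * E x).
Proof. by move=> lE a x y; rewrite lE mulrDr scalerAr. Qed.

Lemma bilinP V W X (b : V -> W -> X) :
  (forall w, linear (fun v => b v w)) -> (forall v, linear (b v)) -> bilin b.
Proof. by move=> h1 h2; split=> [a v v' w|a v]; [apply: h1 | apply: h2]. Qed.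

Lemma eq_bilin V W X (b c : V -> W -> X) :
  (forall v w, b v w = c v w) -> bilin c -> bilin b.
Proof. by move=> e [h1 h2]; split=> *; rewrite !e ?h1 ?h2. Qed.

Lemma bilin_l V W X (b : V -> W -> X) : bilin b -> forall w, linear (fun v => b v w).
Proof. by case=> h _ w a v v'; apply: h. Qed.

Lemma bilin_r V W X (b : V -> W -> X) : bilin b -> forall v, linear (b v).
Proof. by case=> _ h v a w w'; apply: h. Qed.

Lemma trilinP U V W X (b : U -> V -> W -> X) :
  (forall w, bilin (fun u v => b u v w)) -> (forall u v, linear (b u v)) -> trilin b.
Proof.
move=> h1 h2; split=> [a x x' y z|a x y y' z|a x y]; last exact: h2.
- by case: (h1 z) => h _; apply: h.
- by case: (h1 z) => _ h; apply: h.
Qed.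

Lemma trilin_12 U V W X (b : U -> V -> W -> X) :
  trilin b -> forall w, bilin (fun u v => b u v w).
Proof. by case=> h1 h2 _ w; split=> *; [apply: h1 | apply: h2]. Qed.

Lemma trilin_23 U V W X (b : U -> V -> W -> X) : trilin b -> forall u, bilin (b u).
Proof. by case=> _ h2 h3 u; split=> *; [apply: h2 | apply: h3]. Qed.

Lemma quadlinP U V W Y X (b : U -> V -> W -> Y -> X) :
  (forall w y, bilin (fun u v => b u v w y)) -> (forall u v, bilin (b u v)) -> quadlin b.
Proof.
move=> h1 h2; split=> [a x x' y z t|a x y y' z t|a x y z z' t|a x y z t t'].
- by case: (h1 z t) => h _; apply: h.
- by case: (h1 z t) => _ h; apply: h.
- by case: (h2 x y) => h _; apply: h.
- by case: (h2 x y) => _ h; apply: h.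
Qed.

Lemma quadlin_12 U V W Y X (b : U -> V -> W -> Y -> X) :
  quadlin b -> forall w y, bilin (fun u v => b u v w y).
Proof. by case=> h1 h2 _ _ w y; split=> *; [apply: h1 | apply: h2]. Qed.

Lemma quadlin_34 U V W Y X (b : U -> V -> W -> Y -> X) :
  quadlin b -> forall u v, bilin (b u v).
Proof. by case=> _ _ h1 h2 u v; split=> *; [apply: h1 | apply: h2]. Qed.

Lemma ev_tscale V W X (b : V -> W -> X) a s :
  bilin b -> ev b (tscale a s) = a *: ev b s.
Proof.
move=> lb; rewrite /ev /tscale big_map scaler_sumr; apply: eq_bigr => p _ /=.
by rewrite (linear_scale (bilin_l lb p.2)).
Qed.

(** Turns linearity up to equality of tensors into honest bilinearity of every composite with a test
    map, the form in which it is proved and used below. *)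
Lemma bilin_intoP V W X Y (F : V -> W -> seq (X * Y)) :
  bilin_into F <->
  (forall Z (b : X -> Y -> Z), bilin b -> bilin (fun v w => ev b (F v w))).
Proof.
split=> [[h1 h2] Z b lb|h].
- split=> [a v v' w|a v w w'].
  + by rewrite [LHS](h1 _ _ _ _ _ b lb) -/(ev b _) ev_cat (ev_tscale _ _ lb).
  + by rewrite [LHS](h2 _ _ _ _ _ b lb) -/(ev b _) ev_cat (ev_tscale _ _ lb).
- split=> [a v v' w|a v w w'] Z b lb; rewrite -!/(ev b _) ev_cat (ev_tscale _ _ lb).
  + by case: (h Z b lb) => h' _; apply: h'.
  + by case: (h Z b lb) => _ h'; apply: h'.
Qed.

End Multilinear.

(* Closes (multi)linearity goals by recursion on the syntax; maps known to be
   multilinear are taken from the hypotheses. *)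
Ltac mlin :=
  cbv beta;
  lazymatch goal with
  | |- forall _, _ => intro; mlin
  | |- bilin _ => first [ assumption | apply: bilinP; mlin ]
  | |- trilin _ => first [ assumption | apply: trilinP; mlin ]
  | |- quadlin _ => first [ assumption | apply: quadlinP; mlin ]
  | |- GRing.linear_for _ _ => mlin_lin
  end
with mlin_lin :=
  first
  [ assumption
  | match goal with H : forall _, _ |- _ => solve [apply H; mlin] end
  | match goal with
    | |- GRing.linear_for _ (fun x => x) => exact: linear_id
    | |- GRing.linear_for _ (GRing.scale _) => exact: (linear_scaler _ (@linear_id _ _))
    | |- GRing.linear_for _ (GRing.mul _) => exact: (linear_mulr _ (@linear_id _ _))
    | |- GRing.linear_for _ (fun x => ev _ (?s)) => apply: linear_ev; mlin
    | |- GRing.linear_for _ (fun x => ev ?F (?D (@?E x))) =>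
        apply: (@linear_sw _ _ _ _ _ _ D F E); mlin
    | |- GRing.linear_for _ (fun x => ev ?F (?D (@?E x) ?y)) =>
        apply: (@linear_sw _ _ _ _ _ _ (fun w => D w y) F E); mlin
    | |- GRing.linear_for _ (fun x => GRing.scale ?c (@?E x)) => apply: linear_scaler; mlin
    | |- GRing.linear_for _ (fun x => GRing.scale (@?E x) ?c) => apply: linear_scalel; mlin
    | |- GRing.linear_for _ (fun x => GRing.mul ?c (@?E x)) => apply: linear_mulr; mlin
    | |- GRing.linear_for _ (fun x => GRing.mul (@?E x) ?c) => apply: linear_mull; mlin
    | |- GRing.linear_for _ (fun x => ?b (@?E x) ?y ?z ?t) =>
        apply: (linear_comp (g := fun v => b v y z t)); [mlin_base | mlin]
    | |- GRing.linear_for _ (fun x => ?b (@?E x) ?y ?z) =>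
        apply: (linear_comp (g := fun v => b v y z)); [mlin_base | mlin]
    | |- GRing.linear_for _ (fun x => ?b (@?E x) ?y) =>
        apply: (linear_comp (g := fun v => b v y)); [mlin_base | mlin]
    | |- GRing.linear_for _ (fun x => ?g (@?E x)) =>
        apply: (linear_comp (g := g) (E := E)); [mlin_base | mlin]
    | |- _ => mlin_base
    end ]
with mlin_base :=
  cbv beta;
  first
  [ assumption
  | match goal with
    | H : bilin _ |- _ => solve [apply (bilin_l H) | apply (bilin_r H)]
    | H : trilin _ |- _ =>
        solve [ apply (bilin_l (trilin_12 H _)) | apply (bilin_r (trilin_12 H _))
              | apply (bilin_r (trilin_23 H _)) ]
    | H : quadlin _ |- _ =>
        solve [ apply (bilin_l (quadlin_12 H _ _)) | apply (bilin_r (quadlin_12 H _ _))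
              | apply (bilin_l (quadlin_34 H _ _)) | apply (bilin_r (quadlin_34 H _ _)) ]
    | H : forall _, _ |- _ => solve [apply H; mlin]
    end ].

(** * Coalgebra and Hopf algebra axioms as identities of Sweedler sums *)

Section Coalgebra.
Context (k : fieldType) (C : lmodType k) (D : C -> seq (C * C)) (e : C -> k).
Hypothesis cC : coalgebra D e.

(** This is the hypothesis that [linear_sw] asks of [D]; later proofs keep it in the context for
    [mlin]. *)
Lemma linear_comul (X : lmodType k) (b : C -> C -> X) :
  bilin b -> linear (fun x => ev b (D x)).
Proof.
case: cC => lD _ _ _ _ lb a x y.
by rewrite [LHS](lD a x y _ b lb) -/(ev b _) ev_cat (ev_tscale _ _ lb).
Qed.

Lemma linear_counit : linear (e : C -> k^o).
Proof. by case: cC => _ le _ _ _; apply: le. Qed.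

Lemma coassoc (X : lmodType k) (F : C -> C -> C -> X) x : trilin F ->
  \sw_(x', x3 <- D x) \sw_(x1, x2 <- D x') F x1 x2 x3 =
  \sw_(x1, x' <- D x) \sw_(x2, x3 <- D x') F x1 x2 x3.
Proof.
case: cC => _ _ cD _ _ lF; have := cD x X F lF; rewrite !big_allpairs_dep.
by move/esym.
Qed.

Lemma counitl (X : lmodType k) (g : C -> X) x : linear g ->
  \sw_(x1, x2 <- D x) (e x1 *: g x2) = g x.
Proof.
case: cC => _ _ _ he _ lg; rewrite -{2}(he x) -/(ev (fun p q => e p *: q) _).
by rewrite (linear_out _ _ lg); apply: eq_ev => p q; rewrite (linear_scale lg).
Qed.

Lemma counitr (X : lmodType k) (g : C -> X) x : linear g ->
  \sw_(x1, x2 <- D x) (e x2 *: g x1) = g x.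
Proof.
case: cC => _ _ _ _ he lg; rewrite -{2}(he x) -/(ev (fun p q => e q *: p) _).
by rewrite (linear_out _ _ lg); apply: eq_ev => p q; rewrite (linear_scale lg).
Qed.

End Coalgebra.

Section CoalgebraMap.
Context (k : fieldType).
Context (V : lmodType k) (DV : V -> seq (V * V)) (eV : V -> k).
Context (W : lmodType k) (DW : W -> seq (W * W)) (eW : W -> k).
Context (C : lmodType k) (DC : C -> seq (C * C)) (eC : C -> k).

Lemma comul_map2 t (X : lmodType k) (b : C -> C -> X) v w :
  coalg_map2 DV eV DW eW DC eC t -> bilin b ->
  ev b (DC (t v w)) = \sw_(v1, v2 <- DV v) \sw_(w1, w2 <- DW w) b (t v1 w1) (t v2 w2).
Proof. by case=> _ tD _ lb; rewrite [LHS](tD v w _ b lb) big_allpairs_dep. Qed.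

End CoalgebraMap.

Section HopfAlgebra.
Context (k : fieldType) (A : algType k) (D : A -> seq (A * A)) (e : A -> k) (S : A -> A).
Hypothesis hA : hopf_algebra D e S.

Lemma hopf_coalgebra : coalgebra D e. Proof. by case: hA. Qed.

Lemma linear_antipode : linear S.
Proof. by case: hA => _ _ _ lS _; apply: lS. Qed.

Lemma antipodel a : \sw_(a1, a2 <- D a) (S a1 * a2) = e a *: 1.
Proof. by case: hA => _ _ _ _ /(_ a)[]. Qed.

Lemma antipoder a : \sw_(a1, a2 <- D a) (a1 * S a2) = e a *: 1.
Proof. by case: hA => _ _ _ _ /(_ a)[]. Qed.

Lemma counit_mul a b : e (a * b) = e a * e b.
Proof. by case: hA => _ _ []. Qed.

Lemma counit_one : e 1 = 1. Proof. by case: hA => _ _ []. Qed.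

Lemma comul_one (X : lmodType k) (b : A -> A -> X) : bilin b -> ev b (D 1) = b 1 1.
Proof. by case: hA => _ [_ h1] _ _ _ lb; rewrite [LHS](h1 _ b lb) big_seq1. Qed.

End HopfAlgebra.

(** * Convolution of maps [V (x) W -> A] and the splitting of a morphism identity *)

Section Convolution.
Context (k : fieldType) (A : algType k) (DA : A -> seq (A * A)) (eA : A -> k) (SA : A -> A).
Hypothesis hA : hopf_algebra DA eA SA.
Context (V : lmodType k) (DV : V -> seq (V * V)) (eV : V -> k).
Context (W : lmodType k) (DW : W -> seq (W * W)) (eW : W -> k).
Hypotheses (cV : coalgebra DV eV) (cW : coalgebra DW eW).

(** Coassociativity of the coalgebra [V (x) W]: exchanging sums makes the two [V]-sums adjacent,
    after which each factor is coassociative on its own. *)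
Lemma coassoc2 (X : lmodType k) (F : V -> W -> V -> W -> V -> W -> X) v w :
  (forall x2 y2 x3 y3, bilin (fun x1 y1 => F x1 y1 x2 y2 x3 y3)) ->
  (forall x1 y1 x3 y3, bilin (fun x2 y2 => F x1 y1 x2 y2 x3 y3)) ->
  (forall x1 y1 x2 y2, bilin (F x1 y1 x2 y2)) ->
  \sw_(v', v3 <- DV v) \sw_(w', w3 <- DW w)
    \sw_(v1, v2 <- DV v') \sw_(w1, w2 <- DW w') F v1 w1 v2 w2 v3 w3 =
  \sw_(v1, v' <- DV v) \sw_(w1, w' <- DW w)
    \sw_(v2, v3 <- DV v') \sw_(w2, w3 <- DW w') F v1 w1 v2 w2 v3 w3.
Proof.
move=> h1 h2 h3.
have lV := @linear_comul _ _ _ _ cV; have lW := @linear_comul _ _ _ _ cW.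
have h1l x2 y2 x3 y3 y1 : linear (fun x1 => F x1 y1 x2 y2 x3 y3) by exact: (bilin_l (h1 _ _ _ _)).
have h1r x2 y2 x3 y3 x1 : linear (fun y1 => F x1 y1 x2 y2 x3 y3) by exact: (bilin_r (h1 _ _ _ _)).
have h2l x1 y1 x3 y3 y2 : linear (fun x2 => F x1 y1 x2 y2 x3 y3) by exact: (bilin_l (h2 _ _ _ _)).
have h2r x1 y1 x3 y3 x2 : linear (fun y2 => F x1 y1 x2 y2 x3 y3) by exact: (bilin_r (h2 _ _ _ _)).
have h3l x1 y1 x2 y2 y3 : linear (fun x3 => F x1 y1 x2 y2 x3 y3) by exact: (bilin_l (h3 _ _ _ _)).
have h3r x1 y1 x2 y2 x3 : linear (F x1 y1 x2 y2 x3) by exact: (bilin_r (h3 _ _ _ _)).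
transitivity (\sw_(v', v3 <- DV v) \sw_(v1, v2 <- DV v')
  \sw_(w', w3 <- DW w) \sw_(w1, w2 <- DW w') F v1 w1 v2 w2 v3 w3).
  by apply: eq_ev => v' v3; rewrite exchange_ev.
rewrite (coassoc cV (F := fun v1 v2 v3 =>
  \sw_(w', w3 <- DW w) \sw_(w1, w2 <- DW w') F v1 w1 v2 w2 v3 w3)); last by mlin.
apply: eq_ev => v1 v'; rewrite [RHS]exchange_ev; apply: eq_ev => v2 v3.
by rewrite (coassoc cW) //; mlin.
Qed.

Definition conv (F G : V -> W -> A) v w : A :=
  \sw_(v1, v2 <- DV v) \sw_(w1, w2 <- DW w) (F v1 w1 * G v2 w2).

Lemma bilin_conv F G : bilin F -> bilin G -> bilin (conv F G).
Proof.
have lV := @linear_comul _ _ _ _ cV; have lW := @linear_comul _ _ _ _ cW.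
by rewrite /conv; mlin.
Qed.

Lemma eq_conv F F' G G' v w :
  (forall x y, F x y = F' x y) -> (forall x y, G x y = G' x y) ->
  conv F G v w = conv F' G' v w.
Proof. by move=> eF eG; apply: eq_ev => v1 v2; apply: eq_ev => w1 w2; rewrite eF eG. Qed.

Lemma conv_assoc F G K v w : bilin F -> bilin G -> bilin K ->
  conv (conv F G) K v w = conv F (conv G K) v w.
Proof.
move=> lF lG lK.
transitivity (\sw_(v', v3 <- DV v) \sw_(w', w3 <- DW w) \sw_(v1, v2 <- DV v')
   \sw_(w1, w2 <- DW w') (F v1 w1 * G v2 w2 * K v3 w3)).
  apply: eq_ev => v' v3; apply: eq_ev => w' w3.
  rewrite (linear_out (g := fun x => x * K v3 w3)); last by mlin.
  by apply: eq_ev => *; rewrite (linear_out (g := fun x => x * K v3 w3)) //; mlin.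
rewrite coassoc2; [|by mlin..].
apply: eq_ev => v1 v'; apply: eq_ev => w1 w'.
rewrite (linear_out (g := fun x => F v1 w1 * x)); last by mlin.
apply: eq_ev => *; rewrite (linear_out (g := fun x => F v1 w1 * x)); last by mlin.
by apply: eq_ev => *; rewrite mulrA.
Qed.

Lemma counitr2 (X : lmodType k) (F : V -> W -> X) v w : bilin F ->
  \sw_(v1, v2 <- DV v) \sw_(w1, w2 <- DW w) (eV v2 *: (eW w2 *: F v1 w1)) = F v w.
Proof.
move=> lF; rewrite -(counitr cV (g := fun v => F v w)); last by mlin.
apply: eq_ev => v1 v2; rewrite -(linear_out (g := fun x => eV v2 *: x)); last by mlin.
by rewrite (counitr cW) //; mlin.
Qed.

Lemma counitl2 (X : lmodType k) (F : V -> W -> X) v w : bilin F ->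
  \sw_(v1, v2 <- DV v) \sw_(w1, w2 <- DW w) (eV v1 *: (eW w1 *: F v2 w2)) = F v w.
Proof.
move=> lF; rewrite -(counitl cV (g := fun v => F v w)); last by mlin.
apply: eq_ev => v1 v2; rewrite -(linear_out (g := fun x => eV v1 *: x)); last by mlin.
by rewrite (counitl cW) //; mlin.
Qed.

Lemma conv_unitr F v w : bilin F -> conv F (fun x y => (eV x * eW y) *: 1) v w = F v w.
Proof.
move=> lF; rewrite -[RHS]counitr2 //; apply: eq_ev => v1 v2; apply: eq_ev => w1 w2.
by rewrite -scalerAr mulr1 scalerA.
Qed.

Context (H : lmodType k) (DH : H -> seq (H * H)) (eH : H -> k).
Hypothesis cH : coalgebra DH eH.
Context (u : H -> A).
Hypotheses (lu : linear u) (eu : forall h, eA (u h) = eH h).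
Hypothesis Du : forall (X : lmodType k) (b : A -> A -> X) h,
  bilin b -> ev b (DA (u h)) = \sw_(h1, h2 <- DH h) b (u h1) (u h2).
Context (v : V -> W -> H).
Hypothesis mv : coalg_map2 DV eV DW eW DH eH v.

Let lv : bilin v. Proof. by case: mv. Qed.
Let ev_counit x y : eH (v x y) = eV x * eW y. Proof. by case: mv. Qed.

(** Since [u] and [v] are coalgebra maps, the left side is the Sweedler sum of [a_(1) * SA a_(2)] at
    [a = u (v x y)]. *)
Lemma conv_antipoder x y :
  conv (fun x y => u (v x y)) (fun x y => SA (u (v x y))) x y = (eV x * eW y) *: 1.
Proof.
have lS := linear_antipode hA.
rewrite -ev_counit -eu -(antipoder hA) Du; last by mlin.
by rewrite (comul_map2 _ _ mv) //; mlin.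
Qed.

Lemma conv_antipodel x y :
  conv (fun x y => SA (u (v x y))) (fun x y => u (v x y)) x y = (eV x * eW y) *: 1.
Proof.
have lS := linear_antipode hA.
rewrite -ev_counit -eu -(antipodel hA) Du; last by mlin.
by rewrite (comul_map2 _ _ mv) //; mlin.
Qed.

Lemma conv_cancel (F Q : V -> W -> A) : bilin F -> bilin Q ->
  (forall x y, conv F (fun x y => u (v x y)) x y = Q x y) <->
  (forall x y, F x y = conv Q (fun x y => SA (u (v x y))) x y).
Proof.
move=> lF lQ; have lS := linear_antipode hA.
have l1 : bilin (fun x y => u (v x y)) by mlin.
have l2 : bilin (fun x y => SA (u (v x y))) by mlin.
split=> E x y.
- rewrite -(eq_conv _ _ E (fun _ _ => erefl)) conv_assoc //.
  by rewrite (eq_conv _ _ (fun _ _ => erefl) conv_antipoder) conv_unitr.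
- rewrite (eq_conv _ _ E (fun _ _ => erefl)) conv_assoc //.
  by rewrite (eq_conv _ _ (fun _ _ => erefl) conv_antipodel) conv_unitr.
Qed.

Lemma morphism_pair (F Q : V -> W -> A) (w : V -> W -> H) :
  bilin F -> bilin Q -> bilin w ->
  (forall x y, eA (F x y) = eV x * eW y) -> (forall x y, eA (Q x y) = eV x * eW y) ->
  (forall x y, eH (w x y) = eV x * eW y) ->
  (forall (X : lmodType k) (b : A -> H -> X) x y, bilin b ->
     \sw_(x1, x2 <- DV x) \sw_(y1, y2 <- DW y)
        \sw_(h1, h2 <- DH (v x2 y2)) b (F x1 y1 * u h1) h2 =
     \sw_(x1, x2 <- DV x) \sw_(y1, y2 <- DW y) b (Q x1 y1) (w x2 y2)) <->
  (forall x y, v x y = w x y) /\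
  (forall x y, F x y = conv Q (fun x y => SA (u (v x y))) x y).
Proof.
move=> lF lQ lw eF eQ ew.
have lV := @linear_comul _ _ _ _ cV; have lW := @linear_comul _ _ _ _ cW.
have leA := linear_counit (hopf_coalgebra hA); have leH := linear_counit cH.
have luv : bilin (fun x y => u (v x y)) by mlin.
have lP : bilin (conv F (fun x y => u (v x y))) by apply: bilin_conv.
have eP x y : eA (conv F (fun x y => u (v x y)) x y) = eV x * eW y.
  have leV := linear_counit cV; have leW := linear_counit cW.
  (* Scalars are viewed as vectors of [k^o], so that the lemmas on Sweedler sums apply to
     counits. *)
  have le2 : bilin (fun x y => eV x *: (eW y : k^o)) by mlin.
  rewrite -[RHS](counitr2 x y le2) /conv (linear_out _ _ leA); apply: (eq_ev (X := k^o)) => x1 x2.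
  rewrite (linear_out _ _ leA); apply: (eq_ev (X := k^o)) => y1 y2.
  by rewrite (counit_mul hA) eF eu ev_counit -[RHS]/(_ * (_ * _)) mulrC mulrA.
(* Expanding the comultiplication of [v x2 y2] through the coalgebra map [v] and regrouping by
   [coassoc2] collects [F] and [u v] into their convolution. *)
have key (X : lmodType k) (b : A -> H -> X) x y : bilin b ->
    \sw_(x1, x2 <- DV x) \sw_(y1, y2 <- DW y)
        \sw_(h1, h2 <- DH (v x2 y2)) b (F x1 y1 * u h1) h2 =
    \sw_(x1, x2 <- DV x) \sw_(y1, y2 <- DW y)
        b (conv F (fun x y => u (v x y)) x1 y1) (v x2 y2).
  move=> lb.
  transitivity (\sw_(x1, x' <- DV x) \sw_(y1, y' <- DW y) \sw_(x2, x3 <- DV x')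
     \sw_(y2, y3 <- DW y') b (F x1 y1 * u (v x2 y2)) (v x3 y3)).
    apply: eq_ev => x1 x2; apply: eq_ev => y1 y2.
    by rewrite (comul_map2 _ _ mv) //; mlin.
  rewrite -coassoc2; [|by mlin..].
  apply: eq_ev => x1 x2; apply: eq_ev => y1 y2; rewrite /conv.
  rewrite (linear_out (g := fun a => b a (v x2 y2))); last by mlin.
  by apply: eq_ev => *; rewrite (linear_out (g := fun a => b a (v x2 y2))) //; mlin.
have [toF ofF] := conv_cancel lF lQ; split=> [E|[Ev /ofF EP] X b x y lb]; last first.
  rewrite key //; apply: eq_ev => x1 x2; apply: eq_ev => y1 y2.
  by rewrite EP Ev.
split=> [x y|]; last (apply: toF => x y).
(* This test map reduces the [A]-leg of both sides to counits, leaving [v = w]. *)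
- have lb : bilin (fun (a : A) (h : H) => eA a *: h) by mlin.
  have := etrans (esym (key _ _ x y lb)) (E _ _ x y lb).
  rewrite -(counitl2 x y lv) -(counitl2 x y lw) => E'.
  etransitivity; last (etransitivity; first exact: E').
    by apply: eq_ev => x1 x2; apply: eq_ev => y1 y2; rewrite eP scalerA.
  by apply: eq_ev => x1 x2; apply: eq_ev => y1 y2; rewrite eQ scalerA.
(* Dually, the [H]-leg is reduced to counits, leaving [F * uv = Q]. *)
- have lb : bilin (fun (a : A) (h : H) => eH h *: a) by mlin.
  have := etrans (esym (key _ _ x y lb)) (E _ _ x y lb).
  rewrite -(counitr2 x y lP) -(counitr2 x y lQ) => E'.
  etransitivity; last (etransitivity; first exact: E').
    by apply: eq_ev => x1 x2; apply: eq_ev => y1 y2; rewrite ev_counit scalerA.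
  by apply: eq_ev => x1 x2; apply: eq_ev => y1 y2; rewrite ew scalerA.
Qed.

End Convolution.

(** * The unified product as an iterated Sweedler sum *)

Section UnifiedProductSums.
Context (k : fieldType) (A : algType k) (DA : A -> seq (A * A)) (eA : A -> k).
Context (H : lmodType k) (DH : H -> seq (H * H)).

Lemma ev_mulT (X : lmodType k) (b : A -> H -> X) mul s t :
  ev b (mulT mul s t) = \sw_(a, h <- s) \sw_(c, g <- t) ev b (mul a h c g).
Proof. by rewrite /ev /mulT big_flatten big_allpairs_dep. Qed.

Lemma mulT_seq1 mul (x y : A * H) : mulT mul [:: x] [:: y] = mul x.1 x.2 y.1 y.2.
Proof. by rewrite /mulT /= cats0. Qed.

Lemma ev_applyT (X : lmodType k) (b : A -> H -> X) (F : A -> H -> seq (A * H)) s :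
  ev b (applyT F s) = \sw_(a, h <- s) ev b (F a h).
Proof. by rewrite /ev /applyT big_flatten big_map. Qed.

Lemma sum_DT (X : lmodType k) (F : (A * H) * (A * H) -> X) s :
  \sum_(p <- DT DA DH s) F p =
  \sw_(a, h <- s) \sw_(a1, a2 <- DA a) \sw_(h1, h2 <- DH h) F ((a1, h1), (a2, h2)).
Proof.
rewrite /DT big_flatten big_allpairs_dep; apply: eq_bigr => p _.
by apply: eq_bigr => x _; rewrite big_map.
Qed.

Lemma ev_umul (X : lmodType k) (b : A -> H -> X) m lt rt f a h c g :
  ev b (umul DA DH m lt rt f a h c g) =
  \sw_(h1, h' <- DH h) \sw_(h2, h3 <- DH h') \sw_(c1, c' <- DA c) \sw_(c2, c3 <- DA c')
    \sw_(g1, g2 <- DH g) b (a * rt h1 c1 * f (lt h2 c2) g1) (m (lt h3 c3) g2).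
Proof.
rewrite /ev /umul big_flatten big_allpairs_dep.
rewrite sum_delta3; apply: eq_bigr => p _; apply: eq_bigr => q _.
rewrite sum_delta3; apply: eq_bigr => r _; apply: eq_bigr => s _.
by rewrite big_map.
Qed.

Lemma ev_phi_of (X : lmodType k) (b : A -> H -> X) (u : H -> A) a h :
  ev b (phi_of DH u a h) = \sw_(h1, h2 <- DH h) b (a * u h1) h2.
Proof. exact: (ev_map b (fun x _ => a * u x) (fun _ y => y)). Qed.

Lemma umul_mull (X : lmodType k) (b : A -> H -> X) m lt rt f x a h c g :
  ev b (umul DA DH m lt rt f (x * a) h c g) =
  ev (fun y z => b (x * y) z) (umul DA DH m lt rt f a h c g).
Proof. by rewrite !ev_umul; do 5!apply: eq_ev => ? ?; rewrite !mulrA. Qed.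

End UnifiedProductSums.

(* Keeps unification in [mlin] from unfolding them. *)
#[local] Opaque umul phi_of.

(** * Special products, and the coalgebra map property of [m] *)

Section UnifiedProduct.
Context (k : fieldType) (A : algType k) (DA : A -> seq (A * A)) (eA : A -> k).
Context (H : lmodType k) (DH : H -> seq (H * H)) (eH : H -> k) (oneH : H).
Context (SA : A -> A) (hA : hopf_algebra DA eA SA).
Context (m : H -> H -> H) (lt : H -> A -> H) (rt : H -> A -> A) (f : H -> H -> A).
Hypothesis hE : hopf_ext_struct DA eA DH eH oneH m lt rt f.

Local Notation umul := (umul DA DH m lt rt f).

Lemma ext_coalgebra : coalgebra DH eH. Proof. by case: hE => [[]]. Qed.
Lemma ext_bilin_m : bilin m. Proof. by case: hE => [[_ []]]. Qed.
Lemma ext_lt : coalg_map2 DH eH DA eA DH eH lt. Proof. by case: hE => [[_ _ _ []]]. Qed.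
Lemma ext_rt : coalg_map2 DH eH DA eA DA eA rt. Proof. by case: hE => [[_ _ _ []]]. Qed.
Lemma ext_f : coalg_map2 DH eH DH eH DA eA f. Proof. by case: hE => [[_ _ _ []]]. Qed.

Let lDA := @linear_comul _ _ _ _ (hopf_coalgebra hA).
Let lDH := @linear_comul _ _ _ _ ext_coalgebra.
Let leA := linear_counit (hopf_coalgebra hA).
Let leH := linear_counit ext_coalgebra.
Let lm := ext_bilin_m.
Let llt : bilin lt. Proof. by case: ext_lt. Qed.
Let lrt : bilin rt. Proof. by case: ext_rt. Qed.
Let lf : bilin f. Proof. by case: ext_f. Qed.

Lemma ext_comul_one (X : lmodType k) (b : H -> H -> X) : bilin b -> ev b (DH oneH) = b oneH oneH.
Proof. by case: hE => [[_ _ h1 _ _] _] lb; rewrite [LHS](h1 _ b lb) big_seq1. Qed.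

(** Read off from the counit of [1 >< 1] in the unified product, together with [eA 1 = 1]. *)
Lemma ext_counit_one : eH oneH = 1.
Proof.
case: hE => _ [_ _ _ [_ +] _].
by rewrite /epsT big_seq1 /= (counit_one hA) mul1r.
Qed.

Lemma bilin_umul12 (X : lmodType k) (b : A -> H -> X) c g :
  bilin b -> bilin (fun a h => ev b (umul a h c g)).
Proof. by move=> lb; apply: (eq_bilin (fun a h => ev_umul DA DH b m lt rt f a h c g)); mlin. Qed.

Lemma bilin_umul34 (X : lmodType k) (b : A -> H -> X) a h :
  bilin b -> bilin (fun c g => ev b (umul a h c g)).
Proof. by move=> lb; apply: (eq_bilin (ev_umul DA DH b m lt rt f a h)); mlin. Qed.

(** Stated one variable at a time so that [mlin] can take the facts from the context, [umul] being
    opaque to it. *)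
Lemma linear_umul :
  [/\ (forall (X : lmodType k) (b : A -> H -> X) h c g,
         bilin b -> linear (fun a => ev b (umul a h c g))),
      (forall (X : lmodType k) (b : A -> H -> X) a c g,
         bilin b -> linear (fun h => ev b (umul a h c g))),
      (forall (X : lmodType k) (b : A -> H -> X) a h g,
         bilin b -> linear (fun c => ev b (umul a h c g))) &
      (forall (X : lmodType k) (b : A -> H -> X) a h c,
         bilin b -> linear (fun g => ev b (umul a h c g)))].
Proof.
split=> X b ? ? ? lb.
- exact: (bilin_l (bilin_umul12 _ _ lb)).
- exact: (bilin_r (bilin_umul12 _ _ lb)).
- exact: (bilin_l (bilin_umul34 _ _ lb)).
- exact: (bilin_r (bilin_umul34 _ _ lb)).
Qed.

Lemma umul_assoc (X : lmodType k) (b : A -> H -> X) a h c g a' h' : bilin b ->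
  \sw_(x, y <- umul a h c g) ev b (umul x y a' h') =
  \sw_(x, y <- umul c g a' h') ev b (umul a h x y).
Proof.
move=> lb; case: hE => _ [/(_ (a, h) (c, g) (a', h')) E _ _ _ _].
have := E X b lb; rewrite !mulT_seq1 /= -!/(ev b _) !ev_mulT ev_seq1.
under eq_ev do rewrite ev_seq1.
by move=> ->.
Qed.

(** At [g = oneH] the factor [f] becomes the counit of [lt h2 c2], hence [eH h2] times [eA c2], and
    the two middle legs are absorbed. *)
Lemma umul_right1 (X : lmodType k) (b : A -> H -> X) a h c : bilin b ->
  ev b (umul a h c oneH) =
  \sw_(h1, h2 <- DH h) \sw_(c1, c2 <- DA c) b (a * rt h1 c1) (lt h2 c2).
Proof.
move=> lb; rewrite ev_umul; case: (hE) => [[_ [_ m1] _ _ [_ _ _ _ f1]] _].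
have elt x y : eH (lt x y) = eH x * eA y by case: ext_lt.
apply: eq_ev => h1 h'.
transitivity (\sw_(c1, c' <- DA c) \sw_(h2, h3 <- DH h') \sw_(c2, c3 <- DA c')
  (eH h2 *: (eA c2 *: b (a * rt h1 c1) (lt h3 c3)))).
  rewrite exchange_ev; apply: eq_ev => c1 c'; apply: eq_ev => h2 h3; apply: eq_ev => c2 c3.
  rewrite ext_comul_one; last by mlin.
  rewrite (f1 _).1 elt (m1 _).2 -scalerAr mulr1 scalerA.
  by rewrite (linear_scale (bilin_l lb _)).
by apply: eq_ev => c1 c'; rewrite (counitl2 ext_coalgebra (hopf_coalgebra hA)
  (F := fun h c => b (a * rt h1 c1) (lt h c))) //; mlin.
Qed.

(** At [c = 1] the action [rt] becomes a counit on the first leg of [h], and [lt] becomes the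
    identity. *)
Lemma umul_left1 (X : lmodType k) (b : A -> H -> X) a h g : bilin b ->
  ev b (umul a h 1 g) =
  \sw_(h1, h2 <- DH h) \sw_(g1, g2 <- DH g) b (a * f h1 g1) (m h2 g2).
Proof.
move=> lb; rewrite ev_umul; case: (hE) => [[_ _ _ _ [rt1 _ _ lt1 _]] _].
rewrite -[RHS](counitl ext_coalgebra (g := fun h => \sw_(h1, h2 <- DH h)
  \sw_(g1, g2 <- DH g) b (a * f h1 g1) (m h2 g2))); last by mlin.
apply: eq_ev => h1 h'; rewrite (linear_out (g := fun x => eH h1 *: x)); last by mlin.
apply: eq_ev => h2 h3; rewrite (comul_one hA); last by mlin.
rewrite (comul_one hA); last by mlin.
rewrite (linear_out (g := fun x => eH h1 *: x)); last by mlin.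
apply: eq_ev => g1 g2; rewrite rt1 !lt1 -scalerAr mulr1 -scalerAl.
by rewrite (linear_scale (bilin_l lb _)).
Qed.

(** Its main use is the factorisation of [c >< g] as [(c >< 1)(1 >< g)]. *)
Lemma umul_incl (X : lmodType k) (b : A -> H -> X) a c g : bilin b ->
  ev b (umul a oneH c g) = b (a * c) g.
Proof.
move=> lb; case: (hE) => [[_ [_ m1] _ _ [_ rt1 lt1 _ f1]] _].
rewrite ev_umul ext_comul_one; last by mlin.
rewrite ext_comul_one; last by mlin.
transitivity (\sw_(c1, c' <- DA c) \sw_(c2, c3 <- DA c')
   (eA c2 *: (eA c3 *: b (a * c1) g))).
  apply: eq_ev => c1 c'; apply: eq_ev => c2 c3.
  transitivity (\sw_(g1, g2 <- DH g) (eA c2 *: (eA c3 *: (eH g1 *: b (a * c1) g2)))).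
    apply: eq_ev => g1 g2; rewrite rt1 !lt1.
    rewrite (linear_scale (bilin_l lf _)) (f1 _).2 (linear_scale (bilin_l lm _)) (m1 _).1.
    rewrite -!scalerAr mulr1 !(linear_scale (bilin_l lb _)) (linear_scale (bilin_r lb _)).
    by rewrite !scalerA mulrAC.
  rewrite -(linear_out (g := fun x : X => eA c2 *: (eA c3 *: x))); last by mlin.
  by rewrite (counitl ext_coalgebra) //; mlin.
rewrite -[RHS](counitr (hopf_coalgebra hA) (g := fun c => b (a * c) g)); last by mlin.
apply: eq_ev => c1 c'.
rewrite (counitl (hopf_coalgebra hA) (g := fun x => eA x *: b (a * c1) g)) //.
by mlin.
Qed.

(** Because [f] preserves counits, applying [eA] to the [A]-leg recovers [m] from the unified
    product; this is how bialgebra axioms descend to [m]. *)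
Lemma counit_umul_left1 (X : lmodType k) (G : H -> X) h g : linear G ->
  \sw_(x, y <- umul 1 h 1 g) (eA x *: G y) = G (m h g).
Proof.
move=> lG; have lb : bilin (fun (x : A) y => eA x *: G y) by mlin.
have ef x y : eA (f x y) = eH x * eH y by case: ext_f.
rewrite (umul_left1 _ _ _ lb).
rewrite -[RHS](counitl2 ext_coalgebra ext_coalgebra (F := fun h g => G (m h g))); last by mlin.
by apply: eq_ev => h1 h2; apply: eq_ev => g1 g2; rewrite mul1r ef scalerA.
Qed.

(** The comultiplication and counit of the unified product are evaluated at [(1 >< h)(1 >< g)], and
    both [A]-legs are killed by [eA]. *)
Lemma ext_m : coalg_map2 DH eH DH eH DH eH m.
Proof.
case: hE => _ [_ _ Dm em _]; split; first exact: lm.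
- move=> h g X b lb; rewrite -/(ev b _) big_allpairs_dep.
  have lB : quadlin (fun x h y g => eA x *: (eA y *: b h g)) by mlin.
  have := Dm.1 (1, h) (1, g) X _ lB.
  rewrite sum_DT mulT_seq1 /=.
  have -> : \sw_(x, y <- umul 1 h 1 g) \sw_(x1, x2 <- DA x) \sw_(y1, y2 <- DH y)
       (eA x1 *: (eA x2 *: b y1 y2)) = ev b (DH (m h g)).
    rewrite -(counit_umul_left1 (G := fun y => ev b (DH y))); last by mlin.
    apply: eq_ev => x y; rewrite -(counitl (hopf_coalgebra hA) (g := fun x => eA x *: ev b (DH y))).
      apply: eq_ev => x1 x2; rewrite (linear_out (g := fun z => eA x1 *: (eA x2 *: z))) //; mlin.
    by mlin.
  move=> ->; rewrite big_flatten big_allpairs_dep sum_DT ev_seq1.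
  transitivity (\sw_(a1, a2 <- DA 1) \sw_(h1, h2 <- DH h) \sw_(c1, c2 <- DA 1)
      \sw_(g1, g2 <- DH g) \sw_(x, y <- umul a1 h1 c1 g1) \sw_(x', y' <- umul a2 h2 c2 g2)
      (eA x *: (eA x' *: b y y'))).
    apply: eq_ev => a1 a2; apply: eq_ev => h1 h2; rewrite sum_DT ev_seq1.
    apply: eq_ev => c1 c2; apply: eq_ev => g1 g2.
    by rewrite big_allpairs_dep !mulT_seq1.
  have [l1 _ l3 _] := linear_umul.
  rewrite (comul_one hA); last by mlin.
  rewrite -[RHS]/(\sw_(h1, h2 <- DH h) \sw_(g1, g2 <- DH g) b (m h1 g1) (m h2 g2)).
  apply: eq_ev => h1 h2; rewrite (comul_one hA); last by mlin.
  apply: eq_ev => g1 g2.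
  transitivity (\sw_(x, y <- umul 1 h1 1 g1) (eA x *: b y (m h2 g2))); last first.
    by rewrite counit_umul_left1 //; mlin.
  apply: eq_ev => x y; rewrite -(linear_out (g := fun z => eA x *: z)); last by mlin.
  by rewrite counit_umul_left1 //; mlin.
- move=> h g; have := em.1 (1, h) (1, g); rewrite mulT_seq1 /epsT !big_seq1 /= (counit_one hA).
  rewrite !mul1r => <-; rewrite -[LHS](counit_umul_left1 (G := eH : H -> k^o)) //; exact: leH.
Qed.

End UnifiedProduct.

(** * Coassociativity with four legs *)

Section CoassocMore.
Context (k : fieldType) (C : lmodType k) (D : C -> seq (C * C)) (e : C -> k).
Hypothesis cC : coalgebra D e.
Let lD := @linear_comul _ _ _ _ cC.

(** Convolution splits off the last leg first, whereas [delta4] nests to the right; this passes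
    between the two. *)
Lemma coassoc4 (X : lmodType k) (F : C -> C -> C -> C -> X) x : quadlin F ->
  \sw_(x', x4 <- D x) \sw_(x1, x'' <- D x') \sw_(x2, x3 <- D x'') F x1 x2 x3 x4 =
  \sw_(x1, y <- D x) \sw_(x2, z <- D y) \sw_(x3, x4 <- D z) F x1 x2 x3 x4.
Proof.
move=> lF; rewrite (coassoc cC (F := fun x1 x'' x4 =>
  \sw_(x2, x3 <- D x'') F x1 x2 x3 x4)); last by mlin.
by apply: eq_ev => x1 y; rewrite (coassoc cC) //; mlin.
Qed.

(** Exposes legs 2 and 3 as the comultiplication of one element, where the lazy condition can
    act. *)
Lemma coassoc_middle (X : lmodType k) (F : C -> C -> C -> C -> X) x : quadlin F ->
  \sw_(x', x'' <- D x) \sw_(x1, x2 <- D x') \sw_(x3, x4 <- D x'') F x1 x2 x3 x4 =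
  \sw_(x1, y <- D x) \sw_(z, x4 <- D y) \sw_(x2, x3 <- D z) F x1 x2 x3 x4.
Proof.
move=> lF; rewrite (coassoc cC (F := fun x1 x2 x'' =>
  \sw_(x3, x4 <- D x'') F x1 x2 x3 x4)); last by mlin.
by apply: eq_ev => x1 y; rewrite -(coassoc cC) //; mlin.
Qed.

End CoassocMore.

Lemma comul_mul (k : fieldType) (A : algType k) (D : A -> seq (A * A)) (e : A -> k) (S : A -> A)
    (X : lmodType k) (b : A -> A -> X) a c : hopf_algebra D e S -> bilin b ->
  ev b (D (a * c)) = \sw_(a1, a2 <- D a) \sw_(c1, c2 <- D c) b (a1 * c1) (a2 * c2).
Proof. by case=> _ [h _] _ _ _ lb; rewrite [LHS](h a c _ b lb) big_allpairs_dep. Qed.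

(** * The map [a >< h |-> a u(h1) >< h2] *)

Section PhiOf.
Context (k : fieldType) (A : algType k) (H : lmodType k) (DH : H -> seq (H * H)) (eH : H -> k).
Hypothesis cH : coalgebra DH eH.
Let lDH := @linear_comul _ _ _ _ cH.

Lemma phi_of_mull (X : lmodType k) (b : A -> H -> X) (u : H -> A) x a h :
  ev b (phi_of DH u (x * a) h) = ev (fun y z => b (x * y) z) (phi_of DH u a h).
Proof. by rewrite !ev_phi_of; apply: eq_ev => h1 h2; rewrite mulrA. Qed.

Lemma bilin_phi_of (X : lmodType k) (b : A -> H -> X) (u : H -> A) :
  linear u -> bilin b -> bilin (fun a h => ev b (phi_of DH u a h)).
Proof. by move=> lu lb; apply: (eq_bilin (ev_phi_of DH b u)); mlin. Qed.

(** The composite sends [a >< h] to [a v(h1) u(h2) >< h3], so it is the identity once [v * u] is the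
    convolution unit. *)
Lemma phi_of_inverse (X : lmodType k) (b : A -> H -> X) (u v : H -> A) a h :
  linear u -> linear v -> bilin b ->
  (forall h, \sw_(h1, h2 <- DH h) (v h1 * u h2) = eH h *: 1) ->
  ev b (applyT (phi_of DH u) (phi_of DH v a h)) = b a h.
Proof.
move=> lu lv lb vu; rewrite ev_applyT ev_phi_of.
transitivity (\sw_(h1, h' <- DH h) \sw_(h2, h3 <- DH h') b (a * v h1 * u h2) h3).
  by apply: eq_ev => *; rewrite ev_phi_of.
rewrite -(coassoc cH (F := fun h1 h2 h3 => b (a * v h1 * u h2) h3)); last by mlin.
rewrite -[RHS](counitl cH (g := b a)); last by mlin.
apply: eq_ev => h' h3; rewrite -(linear_scale (bilin_l lb _)).
have -> : eH h' *: a = a * \sw_(h1, h2 <- DH h') (v h1 * u h2) by rewrite vu -scalerAr mulr1.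
rewrite (linear_out (g := fun x => b (a * x) h3)); last by mlin.
by apply: eq_ev => *; rewrite mulrA.
Qed.

End PhiOf.

(** * The map defined by a lazy cocycle: multiplicativity, comultiplicativity, inverse *)

Section Morphism.
Context (k : fieldType) (A : algType k) (DA : A -> seq (A * A)) (eA : A -> k) (SA : A -> A).
Context (H : lmodType k) (DH : H -> seq (H * H)) (eH : H -> k) (oneH : H).
Context (m : H -> H -> H) (lt : H -> A -> H) (rt : H -> A -> A) (f : H -> H -> A).
Context (m' : H -> H -> H) (lt' : H -> A -> H) (rt' : H -> A -> A) (f' : H -> H -> A).
Hypothesis hA : hopf_algebra DA eA SA.
Hypothesis hE : hopf_ext_struct DA eA DH eH oneH m lt rt f.
Hypothesis hE' : hopf_ext_struct DA eA DH eH oneH m' lt' rt' f'.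
Context (u : H -> A).
Hypothesis hu : lazy_cocycle DA eA DH eH oneH u.

Local Notation umul := (Defs.umul DA DH m lt rt f).
Local Notation umul' := (Defs.umul DA DH m' lt' rt' f').
Local Notation phi := (phi_of DH u).

Let cA := hopf_coalgebra hA.
Let cH := ext_coalgebra hE.
Let lDA := @linear_comul _ _ _ _ cA.
Let lDH := @linear_comul _ _ _ _ cH.
Let leA := linear_counit cA.
Let leH := linear_counit cH.
Let lS := linear_antipode hA.
Let lu : linear u. Proof. by case: hu => h _ _ _ _; apply: h. Qed.
Let eu h : eA (u h) = eH h. Proof. by case: hu. Qed.
Let u1 : u oneH = 1. Proof. by case: hu. Qed.
Let lm := ext_bilin_m hE.
Let lm' := ext_bilin_m hE'.
Let llt : bilin lt. Proof. by case: (ext_lt hE). Qed.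
Let lrt : bilin rt. Proof. by case: (ext_rt hE). Qed.
Let lf : bilin f. Proof. by case: (ext_f hE). Qed.
Let lrt' : bilin rt'. Proof. by case: (ext_rt hE'). Qed.
Let lf' : bilin f'. Proof. by case: (ext_f hE'). Qed.

Lemma cocycle_comul (X : lmodType k) (b : A -> A -> X) h : bilin b ->
  ev b (DA (u h)) = \sw_(h1, h2 <- DH h) b (u h1) (u h2).
Proof. by case: hu => _ Du _ _ _ lb; rewrite [LHS](Du h X b lb) big_map. Qed.

Lemma cocycle_lazy (X : lmodType k) (b : H -> A -> X) h : bilin b ->
  \sw_(h1, h2 <- DH h) b h1 (u h2) = \sw_(h1, h2 <- DH h) b h2 (u h1).
Proof. by case: hu => _ _ _ _ lz lb; have := lz h X b lb; rewrite !big_map. Qed.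

(** Of the two middle legs among four, exactly one carries [u]; laziness lets it be either. *)
Lemma lazy_swap (X : lmodType k) (K : H -> A -> H -> H -> X) h : quadlin K ->
  \sw_(h', h'' <- DH h) \sw_(p, q <- DH h') \sw_(s, t <- DH h'') K p (u q) s t =
  \sw_(h', h'' <- DH h) \sw_(p, q <- DH h') \sw_(s, t <- DH h'') K p (u s) q t.
Proof.
move=> lK.
rewrite (coassoc_middle cH (F := fun p q s t => K p (u q) s t)); last by mlin.
rewrite (coassoc_middle cH (F := fun p q s t => K p (u s) q t)); last by mlin.
apply: eq_ev => p y; apply: eq_ev => z t.
by rewrite (cocycle_lazy (b := fun q s => K p s q t)) //; mlin.
Qed.

(** The same exchange for legs 3 and 4 of five: coassociativity peels off leg 1 and leaves the case
    of four legs. *)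
Lemma lazy_swap5 (X : lmodType k) (K : H -> H -> A -> H -> H -> X) h :
  (forall q a t w, linear (fun p => K p q a t w)) -> (forall p, quadlin (K p)) ->
  \sw_(h', h'' <- DH h) \sw_(p, x <- DH h') \sw_(q, s <- DH x) \sw_(t, w <- DH h'')
    K p q (u s) t w =
  \sw_(h', h'' <- DH h) \sw_(p, x <- DH h') \sw_(q, t <- DH x) \sw_(s, w <- DH h'')
    K p q (u s) t w.
Proof.
move=> l1 lK.
have l2 p a t w : linear (fun q => K p q a t w) by exact: (bilin_l (quadlin_12 (lK p) _ _)).
have l3 p q t w : linear (fun a => K p q a t w) by exact: (bilin_r (quadlin_12 (lK p) _ _)).
have l4 p q a w : linear (fun t => K p q a t w) by exact: (bilin_l (quadlin_34 (lK p) _ _)).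
have l5 p q a t : linear (K p q a t) by exact: (bilin_r (quadlin_34 (lK p) _ _)).
rewrite (coassoc cH (F := fun p x h'' => \sw_(q, s <- DH x) \sw_(t, w <- DH h'')
  K p q (u s) t w)); last by mlin.
rewrite (coassoc cH (F := fun p x h'' => \sw_(q, t <- DH x) \sw_(s, w <- DH h'')
  K p q (u s) t w)); last by mlin.
by apply: eq_ev => p x; rewrite lazy_swap.
Qed.

(** [actQ] and [mulQ] are the right sides of (i) and (ii) without the antipode factor, and [mulW] is
    the right side of (iii). *)
Definition actQ h c : A := \sw_(h1, h2 <- DH h) (u h1 * rt h2 c).

Definition mulQ h g : A :=
  \sw_(h1, h' <- DH h) \sw_(h2, h3 <- DH h') \sw_(g1, g' <- DH g) \sw_(g2, g3 <- DH g')
    (u h1 * rt h2 (u g1) * f (lt h3 (u g2)) g3).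

Definition mulW h g : H := \sw_(g1, g2 <- DH g) m (lt h (u g1)) g2.

(** The antipode factor comes out with [lt'], which plays [v] in [morphism_pair]; it becomes the
    [lt] of (i) once [lt' = lt] is known. *)
Lemma phi_right1P :
  (forall (X : lmodType k) (b : A -> H -> X) h c, bilin b ->
     \sw_(x, y <- umul' 1 h c oneH) ev b (phi x y) =
     \sw_(x, y <- phi 1 h) ev b (umul x y c oneH)) <->
  (forall h c, lt' h c = lt h c) /\
  (forall h c, rt' h c = conv DH DA actQ (fun h c => SA (u (lt' h c))) h c).
Proof.
have lQ : bilin actQ by rewrite /actQ; mlin.
have eQ h c : eA (actQ h c) = eH h * eA c.
  rewrite /actQ (linear_out _ _ leA).
  rewrite -[RHS](counitl cH (g := fun h => eH h *: (eA c : k^o))); last by mlin.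
  apply: (eq_ev (X := k^o)) => h1 h2; rewrite (counit_mul hA) eu.
  by congr (_ * _); case: (ext_rt hE).
have [_ _ ert'] := ext_rt hE'; have [_ _ elt] := ext_lt hE.
apply: iff_trans
  (morphism_pair hA cH cA cH lu eu cocycle_comul (ext_lt hE') lrt' lQ llt ert' eQ elt).
have eL (X : lmodType k) (b : A -> H -> X) h c : bilin b ->
    \sw_(x, y <- umul' 1 h c oneH) ev b (phi x y) =
    \sw_(x1, x2 <- DH h) \sw_(y1, y2 <- DA c)
      \sw_(h1, h2 <- DH (lt' x2 y2)) b (rt' x1 y1 * u h1) h2.
  move=> lb; rewrite (umul_right1 hA hE') ?mul1r; last exact: (bilin_phi_of cH).
  by apply: eq_ev => h1 h2; apply: eq_ev => c1 c2; rewrite mul1r ev_phi_of.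
have eR (X : lmodType k) (b : A -> H -> X) h c : bilin b ->
    \sw_(x, y <- phi 1 h) ev b (umul x y c oneH) =
    \sw_(x1, x2 <- DH h) \sw_(y1, y2 <- DA c) b (actQ x1 y1) (lt x2 y2).
  move=> lb; rewrite ev_phi_of.
  transitivity (\sw_(h1, h' <- DH h) \sw_(h2, h3 <- DH h') \sw_(c1, c2 <- DA c)
      b (u h1 * rt h2 c1) (lt h3 c2)).
    by apply: eq_ev => h1 h'; rewrite (umul_right1 hA hE) // mul1r.
  (* Gathers [h1] and [h2] over a common [h'], which produces [actQ h' c1]. *)
  rewrite -(coassoc cH (F := fun h1 h2 h3 => \sw_(c1, c2 <- DA c)
      b (u h1 * rt h2 c1) (lt h3 c2))); last by mlin.
  apply: eq_ev => h' h3; rewrite exchange_ev; apply: eq_ev => c1 c2.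
  by rewrite /actQ (linear_out (g := fun x => b x (lt h3 c2))) //; mlin.
by split=> E X b h c lb; move: (E X b h c lb); rewrite eL // eR.
Qed.

(** Here laziness enters multiplicativity: without exchanging two legs of [g], the product of the
    images is not of the form [Q (x) w]. *)
Lemma phi_left1P :
  (forall (X : lmodType k) (b : A -> H -> X) h g, bilin b ->
     \sw_(x, y <- umul' 1 h 1 g) ev b (phi x y) =
     \sw_(x, y <- phi 1 h) \sw_(z, w <- phi 1 g) ev b (umul x y z w)) <->
  (forall h g, m' h g = mulW h g) /\
  (forall h g, f' h g = conv DH DH mulQ (fun h g => SA (u (m' h g))) h g).
Proof.
have lQ : bilin mulQ by rewrite /mulQ; mlin.
have lW : bilin mulW by rewrite /mulW; mlin.
have [_ _ ert] := ext_rt hE; have [_ _ elt] := ext_lt hE; have [_ _ ef] := ext_f hE.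
have [_ _ em] := ext_m hA hE; have [_ _ ef'] := ext_f hE'.
have eW h g : eH (mulW h g) = eH h * eH g.
  rewrite /mulW (linear_out _ _ leH).
  rewrite -[RHS](counitl cH (g := fun g => eH h *: (eH g : k^o))); last by mlin.
  apply: (eq_ev (X := k^o)) => g1 g2; rewrite em elt eu -[RHS]/(_ * (_ * _)).
  by rewrite mulrCA mulrA.
have eQ h g : eA (mulQ h g) = eH h * eH g.
  (* The counits are ordered so that the counit law can treat [h1], [h2], [g1], [g2] one at a
     time. *)
  transitivity (\sw_(h1, h' <- DH h) \sw_(h2, h3 <- DH h') \sw_(g1, g' <- DH g)
      \sw_(g2, g3 <- DH g')
      (eH h1 *: (eH h2 *: (eH g1 *: (eH g2 *: (eH h3 *: (eH g3 : k^o))))))).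
    rewrite /mulQ (linear_out _ _ leA); apply: (eq_ev (X := k^o)) => h1 h'.
    rewrite (linear_out _ _ leA); apply: (eq_ev (X := k^o)) => h2 h3.
    rewrite (linear_out _ _ leA); apply: (eq_ev (X := k^o)) => g1 g'.
    rewrite (linear_out _ _ leA); apply: (eq_ev (X := k^o)) => g2 g3.
    rewrite !(counit_mul hA) ert ef elt !eu.
    rewrite -[RHS]/(_ * (_ * (_ * (_ * (_ * _))))) !mulrA.
    by congr (_ * _); rewrite -!mulrA; do 3!congr (_ * _); rewrite mulrC.
  rewrite -[RHS](counitl cH (g := fun h => eH h *: (eH g : k^o))); last by mlin.
  apply: (eq_ev (X := k^o)) => h1 h'.
  rewrite -[in RHS](counitl cH (g := fun h => eH h *: (eH g : k^o))); last by mlin.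
  rewrite (linear_out (g := fun x : k^o => eH h1 *: x)); last by mlin.
  apply: (eq_ev (X := k^o)) => h2 h3.
  rewrite -[in RHS](counitl cH (g := fun g => eH h3 *: (eH g : k^o))); last by mlin.
  rewrite (linear_out (g := fun x : k^o => eH h1 *: (eH h2 *: x))); last by mlin.
  apply: (eq_ev (X := k^o)) => g1 g'.
  rewrite -[in RHS](counitl cH (g := fun g => eH h3 *: (eH g : k^o))); last by mlin.
  by rewrite (linear_out (g := fun x : k^o => eH h1 *: (eH h2 *: (eH g1 *: x)))) //; mlin.
apply: iff_trans
  (morphism_pair hA cH cH cH lu eu cocycle_comul (ext_m hA hE') lf' lQ lW ef' eQ eW).
have eL (X : lmodType k) (b : A -> H -> X) h g : bilin b ->
    \sw_(x, y <- umul' 1 h 1 g) ev b (phi x y) =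
    \sw_(x1, x2 <- DH h) \sw_(y1, y2 <- DH g)
      \sw_(h1, h2 <- DH (m' x2 y2)) b (f' x1 y1 * u h1) h2.
  move=> lb; rewrite (umul_left1 hA hE') ?mul1r; last exact: (bilin_phi_of cH).
  by apply: eq_ev => h1 h2; apply: eq_ev => g1 g2; rewrite mul1r ev_phi_of.
have eR (X : lmodType k) (b : A -> H -> X) h g : bilin b ->
    \sw_(x, y <- phi 1 h) \sw_(z, w <- phi 1 g) ev b (umul x y z w) =
    \sw_(x1, x2 <- DH h) \sw_(y1, y2 <- DH g) b (mulQ x1 y1) (mulW x2 y2).
  move=> lb; rewrite ev_phi_of.
  (* Since [u] is comultiplicative, the legs of [u g1] are [u p, u q, u s]; the legs of [g] occur in
     the order [p, q, s, t, w]. *)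
  transitivity (\sw_(h1, y <- DH h) \sw_(h2, z <- DH y) \sw_(h3, h4 <- DH z)
      \sw_(g1, g' <- DH g) \sw_(p, x <- DH g1) \sw_(q, s <- DH x) \sw_(t, w <- DH g')
      b (u h1 * rt h2 (u p) * f (lt h3 (u q)) t) (m (lt h4 (u s)) w)).
    apply: eq_ev => h1 y; rewrite ev_phi_of.
    transitivity (\sw_(g1, g' <- DH g) \sw_(h2, z <- DH y) \sw_(h3, h4 <- DH z)
      \sw_(p, x <- DH g1) \sw_(q, s <- DH x) \sw_(t, w <- DH g')
      b (u h1 * rt h2 (u p) * f (lt h3 (u q)) t) (m (lt h4 (u s)) w)); last first.
      by rewrite exchange_ev; apply: eq_ev => h2 z; rewrite exchange_ev.
    apply: eq_ev => g1 g'; rewrite ev_umul.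
    apply: eq_ev => h2 z; apply: eq_ev => h3 h4; rewrite !mul1r cocycle_comul; last by mlin.
    apply: eq_ev => p x; rewrite cocycle_comul; last by mlin.
    by apply: eq_ev.
  (* Laziness puts [t] before [s], so that [p, q, t] serve [mulQ] and [s, w] serve [mulW]. *)
  transitivity (\sw_(h1, y <- DH h) \sw_(h2, z <- DH y) \sw_(h3, h4 <- DH z)
      \sw_(g1, g' <- DH g) \sw_(p, x <- DH g1) \sw_(q, t <- DH x) \sw_(s, w <- DH g')
      b (u h1 * rt h2 (u p) * f (lt h3 (u q)) t) (m (lt h4 (u s)) w)).
    apply: eq_ev => h1 y; apply: eq_ev => h2 z; apply: eq_ev => h3 h4.
    by apply: (lazy_swap5 (K := fun p q a t w =>
      b (u h1 * rt h2 (u p) * f (lt h3 (u q)) t) (m (lt h4 a) w))); mlin.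
  rewrite -(coassoc4 cH (F := fun h1 h2 h3 h4 => \sw_(g1, g' <- DH g) \sw_(p, x <- DH g1)
      \sw_(q, t <- DH x) \sw_(s, w <- DH g')
      b (u h1 * rt h2 (u p) * f (lt h3 (u q)) t) (m (lt h4 (u s)) w))); last by mlin.
  apply: eq_ev => h' h4.
  transitivity (\sw_(g1, g' <- DH g) \sw_(h1, h'' <- DH h') \sw_(h2, h3 <- DH h'')
      \sw_(p, x <- DH g1) \sw_(q, t <- DH x) \sw_(s, w <- DH g')
      b (u h1 * rt h2 (u p) * f (lt h3 (u q)) t) (m (lt h4 (u s)) w)).
    by rewrite [RHS]exchange_ev; apply: eq_ev => h1 h''; rewrite [RHS]exchange_ev.
  apply: eq_ev => g1 g'; rewrite /mulQ.
  rewrite (linear_out (g := fun x => b x (mulW h4 g'))); last by mlin.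
  apply: eq_ev => h1 h''.
  rewrite (linear_out (g := fun x => b x (mulW h4 g'))); last by mlin.
  apply: eq_ev => h2 h3.
  rewrite (linear_out (g := fun x => b x (mulW h4 g'))); last by mlin.
  apply: eq_ev => p x.
  rewrite (linear_out (g := fun x => b x (mulW h4 g'))); last by mlin.
  by apply: eq_ev => q t; rewrite /mulW [RHS](linear_out (g := b _)) //; mlin.
by split=> E X b h g lb; move: (E X b h g lb); rewrite eL // eR.
Qed.

(** Translates the convolution form of the criterion into condition (i); [conv_mulQ] does the same
    for (ii). *)
Lemma conv_actQ h c :
  conv DH DA actQ (fun h c => SA (u (lt h c))) h c =
  \sum_(x <- delta3 DH h) \sum_(y <- DA c)
     u x.1.1 * rt x.1.2 y.1 * SA (u (lt x.2 y.2)).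
Proof.
rewrite sum_delta3 -[RHS]/(\sw_(h1, h' <- DH h) \sw_(h2, h3 <- DH h') \sw_(c1, c2 <- DA c)
  (u h1 * rt h2 c1 * SA (u (lt h3 c2)))).
rewrite -(coassoc cH (F := fun h1 h2 h3 => \sw_(c1, c2 <- DA c)
  (u h1 * rt h2 c1 * SA (u (lt h3 c2))))); last by mlin.
apply: eq_ev => h' h3; rewrite [RHS]exchange_ev; apply: eq_ev => c1 c2.
by rewrite (linear_out (g := fun x => x * SA (u (lt h3 c2)))) //; mlin.
Qed.

Lemma conv_mulQ h g :
  conv DH DH mulQ (fun h g => SA (u (m' h g))) h g =
  \sum_(x <- delta4 DH h) \sum_(y <- delta4 DH g)
     u x.1.1.1 * rt x.1.1.2 (u y.1.1.1) * f (lt x.1.2 (u y.1.1.2)) y.1.2 * SA (u (m' x.2 y.2)).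
Proof.
rewrite sum_delta4.
transitivity (\sw_(h1, y <- DH h) \sw_(h2, z <- DH y) \sw_(h3, h4 <- DH z)
  \sw_(g1, y <- DH g) \sw_(g2, z <- DH y) \sw_(g3, g4 <- DH z)
  (u h1 * rt h2 (u g1) * f (lt h3 (u g2)) g3 * SA (u (m' h4 g4)))); last first.
  by do 3!apply: eq_ev => ? ?; rewrite sum_delta4.
rewrite -(coassoc4 cH (F := fun h1 h2 h3 h4 => \sw_(g1, y <- DH g) \sw_(g2, z <- DH y)
  \sw_(g3, g4 <- DH z)
  (u h1 * rt h2 (u g1) * f (lt h3 (u g2)) g3 * SA (u (m' h4 g4))))); last by mlin.
apply: eq_ev => h' h4.
transitivity (\sw_(g', g4 <- DH g) \sw_(h1, h'' <- DH h') \sw_(h2, h3 <- DH h'')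
  \sw_(g1, g'' <- DH g') \sw_(g2, g3 <- DH g'')
  (u h1 * rt h2 (u g1) * f (lt h3 (u g2)) g3 * SA (u (m' h4 g4)))).
  apply: eq_ev => g' g4; rewrite /mulQ.
  rewrite (linear_out (g := fun x => x * SA (u (m' h4 g4)))); last by mlin.
  apply: eq_ev => h1 h''.
  rewrite (linear_out (g := fun x => x * SA (u (m' h4 g4)))); last by mlin.
  apply: eq_ev => h2 h3.
  rewrite (linear_out (g := fun x => x * SA (u (m' h4 g4)))); last by mlin.
  apply: eq_ev => g1 g''.
  by rewrite (linear_out (g := fun x => x * SA (u (m' h4 g4)))) //; mlin.
rewrite exchange_ev; apply: eq_ev => h1 h''; rewrite exchange_ev; apply: eq_ev => h2 h3.
by rewrite (coassoc4 cH (F := fun g1 g2 g3 g4 =>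
  u h1 * rt h2 (u g1) * f (lt h3 (u g2)) g3 * SA (u (m' h4 g4)))) //; mlin.
Qed.

(* [A >< H] is generated by [a >< 1] and [1 >< h], so by associativity and
   [A]-linearity these two kinds of right factors suffice. *)
Lemma phi_multiplicative :
  (forall (X : lmodType k) (b : A -> H -> X) h c, bilin b ->
     \sw_(x, y <- umul' 1 h c oneH) ev b (phi x y) =
     \sw_(x, y <- phi 1 h) ev b (umul x y c oneH)) ->
  (forall (X : lmodType k) (b : A -> H -> X) h g, bilin b ->
     \sw_(x, y <- umul' 1 h 1 g) ev b (phi x y) =
     \sw_(x, y <- phi 1 h) \sw_(z, w <- phi 1 g) ev b (umul x y z w)) ->
  forall (X : lmodType k) (b : A -> H -> X) a h c g, bilin b ->
    \sw_(x, y <- umul' a h c g) ev b (phi x y) =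
    \sw_(x, y <- phi a h) \sw_(z, w <- phi c g) ev b (umul x y z w).
Proof.
move=> right1 left1.
have [l1 l2 l3 l4] := linear_umul hA hE.
have [l1' l2' l3' l4'] := linear_umul hA hE'.
have lphi (X : lmodType k) (b : A -> H -> X) : bilin b -> bilin (fun a h => ev b (phi a h)).
  exact: (bilin_phi_of cH).
have p1 (X : lmodType k) (b : A -> H -> X) h : bilin b -> linear (fun a => ev b (phi a h)).
  by move=> lb; exact: (bilin_l (lphi _ _ lb)).
have p2 (X : lmodType k) (b : A -> H -> X) a : bilin b -> linear (fun h => ev b (phi a h)).
  by move=> lb; exact: (bilin_r (lphi _ _ lb)).
(* Both products and [phi] are left [A]-linear, so the left factor [a >< h] may be taken with
   [a = 1]. *)
suff base (X : lmodType k) (b : A -> H -> X) h c g : bilin b ->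
    \sw_(x, y <- umul' 1 h c g) ev b (phi x y) =
    \sw_(x, y <- phi 1 h) \sw_(z, w <- phi c g) ev b (umul x y z w).
  move=> X b a h c g lb; have lb' : bilin (fun x y => b (a * x) y) by mlin.
  rewrite -[a]mulr1 umul_mull phi_of_mull.
  under eq_ev do rewrite phi_of_mull.
  rewrite base //; apply: eq_ev => x y; apply: eq_ev => z w.
  by rewrite umul_mull.
(* [K p q] is [b] evaluated on [(p >< q) phi (1 >< g)]. *)
move=> lb; pose K p q := \sw_(z, w <- phi 1 g) ev b (umul p q z w).
have lK : bilin K by rewrite /K; mlin.
(* Factor [c >< g] as [(c >< 1)(1 >< g)] and reassociate in the source. *)
transitivity (\sw_(x, y <- umul' c oneH 1 g) \sw_(p, q <- umul' 1 h x y) ev b (phi p q)).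
  by rewrite (umul_incl hA hE') ?mulr1 //; mlin.
rewrite -(umul_assoc hE'); last exact: lphi.
transitivity (\sw_(x, y <- umul' 1 h c oneH) ev K (phi x y)).
  apply: eq_ev => x y; have lb' : bilin (fun p q => b (x * p) q) by mlin.
  rewrite -[x]mulr1 umul_mull phi_of_mull.
  under eq_ev do rewrite phi_of_mull.
  rewrite left1 //; apply: eq_ev => p q; apply: eq_ev => z w.
  by rewrite umul_mull.
(* Reassociate in the target, where [(c >< 1) phi (1 >< g)] is [phi (c >< g)]. *)
rewrite right1 //; apply: eq_ev => x y.
rewrite /K exchange_ev -[c in RHS]mulr1 phi_of_mull; apply: eq_ev => z w.
by rewrite (umul_assoc hE) // (umul_incl hA hE) //; mlin.
Qed.

(** With [h] split into four legs, the two sides differ only in whether the second [u] takes leg 2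
    or leg 3. *)
Lemma phi_comul (X : lmodType k) (b : A -> H -> A -> H -> X) a h : quadlin b ->
  \sw_(x, y <- phi a h) \sw_(x1, x2 <- DA x) \sw_(y1, y2 <- DH y) b x1 y1 x2 y2 =
  \sw_(a1, a2 <- DA a) \sw_(h1, h2 <- DH h)
    \sw_(x, y <- phi a1 h1) \sw_(z, w <- phi a2 h2) b x y z w.
Proof.
move=> lb; rewrite ev_phi_of.
transitivity (\sw_(h1, h' <- DH h) \sw_(a1, a2 <- DA a) \sw_(p, q <- DH h1)
    \sw_(s, t <- DH h') b (a1 * u p) s (a2 * u q) t).
  apply: eq_ev => h1 h'; rewrite (comul_mul _ _ hA); last by mlin.
  by apply: eq_ev => a1 a2; rewrite cocycle_comul //; mlin.
rewrite exchange_ev; apply: eq_ev => a1 a2.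
rewrite (lazy_swap _ (K := fun p v s t => b (a1 * u p) s (a2 * v) t)); last by mlin.
apply: eq_ev => h1 h'; rewrite ev_phi_of; apply: eq_ev => p q.
by rewrite ev_phi_of.
Qed.

Lemma cocycle_antipodel h : \sw_(h1, h2 <- DH h) (SA (u h1) * u h2) = eH h *: 1.
Proof.
by rewrite -(cocycle_comul (b := fun x y => SA x * y)) ?(antipodel hA) ?eu //; mlin.
Qed.

Lemma cocycle_antipoder h : \sw_(h1, h2 <- DH h) (u h1 * SA (u h2)) = eH h *: 1.
Proof.
by rewrite -(cocycle_comul (b := fun x y => x * SA y)) ?(antipoder hA) ?eu //; mlin.
Qed.

(** The inverse is the map of the same form built from [SA u]. A general [Phi] is allowed because a
    morphism agrees with [phi] only as tensors, not as sequences. *)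
Lemma lin_bijective_phi (Phi : A -> H -> seq (A * H)) :
  (forall a h, teq2 (Phi a h) (phi a h)) -> lin_bijective Phi.
Proof.
move=> ePhi; pose v h := SA (u h); have lv : linear v by rewrite /v; mlin.
exists (phi_of DH v); split; first by apply/bilin_intoP => X b; exact: (bilin_phi_of cH).
move=> a h; split=> X b lb; rewrite -!/(ev b _) ev_seq1.
- rewrite -(phi_of_inverse cH (v := v) a h lu lv lb cocycle_antipodel) !ev_applyT.
  by apply: eq_ev => x y; exact: ePhi.
- rewrite -(phi_of_inverse cH (u := v) a h lv lu lb cocycle_antipoder) !ev_applyT.
  by apply: (ePhi a h); exact: (bilin_phi_of cH).
Qed.

End Morphism.

(** * The lazy cocycle of a given morphism *)

Section Forward.
Context (k : fieldType) (A : algType k) (DA : A -> seq (A * A)) (eA : A -> k) (SA : A -> A).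
Context (H : lmodType k) (DH : H -> seq (H * H)) (eH : H -> k) (oneH : H).
Context (m : H -> H -> H) (lt : H -> A -> H) (rt : H -> A -> A) (f : H -> H -> A).
Hypothesis hA : hopf_algebra DA eA SA.
Hypothesis hE : hopf_ext_struct DA eA DH eH oneH m lt rt f.
Context (mul' mul : A -> H -> A -> H -> seq (A * H)) (Phi : A -> H -> seq (A * H)).
Hypothesis mPhi : ext_morphism DA eA DH eH oneH mul' mul Phi.

Let cA := hopf_coalgebra hA.
Let cH := ext_coalgebra hE.
Let lDA := @linear_comul _ _ _ _ cA.
Let lDH := @linear_comul _ _ _ _ cH.
Let leA := linear_counit cA.
Let leH := linear_counit cH.

Definition cocycle_of h : A := \sw_(a, h' <- Phi 1 h) (eH h' *: a).
Local Notation u := cocycle_of.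

Lemma linear_cocycle_of : linear u.
Proof.
case: mPhi => /bilin_intoP lPhi _ _ _ _; rewrite /cocycle_of.
have lb : bilin (fun (a : A) (h : H) => eH h *: a) by mlin.
exact: (bilin_r (lPhi _ _ lb)).
Qed.
Let lu := linear_cocycle_of.

(* Apply [eH] to the middle leg of the comodule condition. *)
Lemma ext_morphism_phi_of a h : teq2 (Phi a h) (phi_of DH u a h).
Proof.
case: mPhi => _ PhiM coPhi _ _ X b lb; rewrite -!/(ev b _) ev_phi_of.
have lT : trilin (fun x y z => eH y *: b x z) by mlin.
have := coPhi a h X _ lT; rewrite !big_allpairs_dep => E.
transitivity (\sw_(x, y <- Phi a h) \sw_(h1, h2 <- DH y) (eH h1 *: b x h2)).
  by apply: eq_ev => x y; rewrite (counitl cH (g := b x)) //; mlin.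
etransitivity; first exact: (esym E).
rewrite -[LHS]/(\sw_(h1, h2 <- DH h) \sw_(x, y <- Phi a h1) (eH y *: b x h2)).
apply: eq_ev => h1 h2; rewrite -[a in LHS]mulr1.
have lb' : bilin (fun x y => eH y *: b x h2) by mlin.
rewrite [LHS](PhiM a 1 h1 X _ lb') big_map.
rewrite -[LHS]/(\sw_(x, y <- Phi 1 h1) (eH y *: b (a * x) h2)) /cocycle_of.
rewrite (linear_out (g := fun x => b (a * x) h2)); last by mlin.
apply: eq_ev => x y.
by rewrite -scalerAr (linear_scale (bilin_l lb _)).
Qed.
Let ePhi := ext_morphism_phi_of.

Lemma cocycle_of_counit h : eA (u h) = eH h.
Proof.
case: mPhi => _ _ _ _ [_ /(_ 1 h)]; rewrite (counit_one hA) mul1r => <-.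
have lb : bilin (fun x y => eA x *: (eH y : k^o)) by mlin.
transitivity (ev (fun x y => eA x *: (eH y : k^o)) (phi_of DH u 1 h)); last first.
  by symmetry; exact: (ePhi 1 h lb).
rewrite ev_phi_of -[LHS](counitr cH (g := fun h => eA (u h) : k^o));
  last exact: (linear_comp leA lu).
by apply: (eq_ev (X := k^o)) => x y; rewrite mul1r /GRing.scale /= mulrC.
Qed.
Let eu := cocycle_of_counit.

(** Comultiplicativity of [Phi] at [1 >< h], kept with all four legs: contracting different pairs of
    legs by counits yields both the coalgebra map property and laziness. *)
Lemma cocycle_of_comul (X : lmodType k) (b : A -> H -> A -> H -> X) h : quadlin b ->
  \sw_(h1, h' <- DH h) \sw_(x1, x2 <- DA (u h1)) \sw_(y1, y2 <- DH h') b x1 y1 x2 y2 =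
  \sw_(h1, h2 <- DH h) \sw_(p, s <- DH h1) \sw_(q, t <- DH h2) b (u p) s (u q) t.
Proof.
move=> lb; case: mPhi => _ _ _ _ [/(_ 1 h X b lb) + _]; rewrite sum_DT => E.
have lphi (Y : lmodType k) (c : A -> H -> Y) : bilin c -> bilin (fun a h => ev c (phi_of DH u a h)).
  exact: (bilin_phi_of cH).
have p1 (Y : lmodType k) (c : A -> H -> Y) h' : bilin c ->
    linear (fun a => ev c (phi_of DH u a h')).
  by move=> lc; exact: (bilin_l (lphi _ _ lc)).
have p2 (Y : lmodType k) (c : A -> H -> Y) a : bilin c -> linear (fun h => ev c (phi_of DH u a h)).
  by move=> lc; exact: (bilin_r (lphi _ _ lc)).
have lb1 : bilin (fun x y => \sw_(x1, x2 <- DA x) \sw_(y1, y2 <- DH y) b x1 y1 x2 y2) by mlin.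
transitivity (\sw_(x, y <- phi_of DH u 1 h) \sw_(x1, x2 <- DA x)
    \sw_(y1, y2 <- DH y) b x1 y1 x2 y2).
  by rewrite ev_phi_of; apply: eq_ev => h1 h'; rewrite mul1r.
etransitivity; first exact: (etrans (esym (ePhi 1 h lb1)) E).
rewrite big_flatten big_map sum_DT ev_seq1.
transitivity (\sw_(a1, a2 <- DA 1) \sw_(h1, h2 <- DH h)
    \sw_(x, y <- phi_of DH u a1 h1) \sw_(z, w <- phi_of DH u a2 h2) b x y z w).
  apply: eq_ev => a1 a2; apply: eq_ev => h1 h2; rewrite big_allpairs_dep.
  have lb2 : bilin (fun x y => \sw_(z, w <- phi_of DH u a2 h2) b x y z w) by mlin.
  transitivity (\sw_(x, y <- Phi a1 h1) \sw_(z, w <- phi_of DH u a2 h2) b x y z w);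
    last exact: (ePhi a1 h1 lb2).
  by apply: eq_bigr => x _; apply: (ePhi a2 h2 (b := b x.1 x.2)); mlin.
rewrite (comul_one hA); last by mlin.
apply: eq_ev => h1 h2; rewrite ev_phi_of; apply: eq_ev => p s; rewrite ev_phi_of mul1r.
by apply: eq_ev => q t; rewrite mul1r.
Qed.

Lemma lazy_cocycle_of : lazy_cocycle DA eA DH eH oneH u.
Proof.
split=> [|h X b lb|h||h X b lb]; [exact: lu| |exact: eu| |]; rewrite -?/(ev b _).
- rewrite (ev_map b (fun x _ => u x) (fun _ y => u y)).
  (* Killing both [H]-legs leaves the comultiplicativity of [u]. *)
  have lq : quadlin (fun x1 y1 x2 y2 => eH y1 *: (eH y2 *: b x1 x2)) by mlin.
  have := cocycle_of_comul h lq.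
  have -> : \sw_(h1, h' <- DH h) \sw_(x1, x2 <- DA (u h1)) \sw_(y1, y2 <- DH h')
      (eH y1 *: (eH y2 *: b x1 x2)) = ev b (DA (u h)).
    rewrite -[RHS](counitr cH (g := fun h => ev b (DA (u h)))); last by mlin.
    apply: eq_ev => h1 h'; rewrite (linear_out (g := fun x => eH h' *: x)); last by mlin.
    apply: eq_ev => x1 x2.
    by rewrite (counitl cH (g := fun y => eH y *: b x1 x2)) //; mlin.
  move=> ->; apply: eq_ev => h1 h2.
  transitivity (\sw_(p, s <- DH h1) (eH s *: b (u p) (u h2))).
    apply: eq_ev => p s; rewrite -(linear_out (g := fun x => eH s *: x)); last by mlin.
    by rewrite (counitr cH (g := fun q => b (u p) (u q))) //; mlin.
  by rewrite (counitr cH (g := fun p => b (u p) (u h2))) //; mlin.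
- case: mPhi => _ _ _ [_ E] _.
  have lb : bilin (fun (a : A) (h : H) => eH h *: a) by mlin.
  by rewrite /cocycle_of [LHS](E _ _ lb) big_seq1 (ext_counit_one hA hE) scale1r.
- rewrite (ev_map b (fun x _ => x) (fun _ y => u y)) (ev_map b (fun _ y => y) (fun x _ => u x)).
  (* Killing the first [A]-leg and the second [H]-leg leaves the lazy condition. *)
  have lq : quadlin (fun x1 y1 x2 y2 => eA x1 *: (eH y2 *: b y1 x2)) by mlin.
  have E := cocycle_of_comul h lq.
  transitivity (\sw_(h1, h2 <- DH h) \sw_(p, s <- DH h1) \sw_(q, t <- DH h2)
      (eA (u p) *: (eH t *: b s (u q)))).
    apply: eq_ev => h1 h2.
    rewrite -[LHS](counitl cH (g := fun s => b s (u h2))); last by mlin.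
    apply: eq_ev => p s; rewrite eu -(linear_out (g := fun x => eH p *: x)); last by mlin.
    by rewrite (counitr cH (g := fun q => b s (u q))) //; mlin.
  rewrite -E; apply: eq_ev => h1 h'.
  transitivity (\sw_(x1, x2 <- DA (u h1)) (eA x1 *: b h' x2)).
    apply: eq_ev => x1 x2; rewrite -(linear_out (g := fun x => eA x1 *: x)); last by mlin.
    by rewrite (counitr cH (g := fun y => b y x2)) //; mlin.
  by rewrite (counitl cA (g := b h')) //; mlin.
Qed.

End Forward.

(** * Both directions of the equivalence *)

Theorem theorem3p4 (k : fieldType) (A : algType k)
  (DA : A -> seq (A * A)) (eA : A -> k) (SA : A -> A)
  (H : lmodType k) (DH : H -> seq (H * H)) (eH : H -> k) (oneH : H)
  (m : H -> H -> H) (lt : H -> A -> H) (rt : H -> A -> A) (f : H -> H -> A)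
  (m' : H -> H -> H) (lt' : H -> A -> H) (rt' : H -> A -> A) (f' : H -> H -> A) :
  hopf_algebra DA eA SA ->
  hopf_ext_struct DA eA DH eH oneH m lt rt f ->
  hopf_ext_struct DA eA DH eH oneH m' lt' rt' f' ->
  let conds (u : H -> A) :=
    [/\ lazy_cocycle DA eA DH eH oneH u,
        (* (i) *)
        (forall h c, rt' h c =
           \sum_(x <- delta3 DH h) \sum_(y <- DA c)
              u x.1.1 * rt x.1.2 y.1 * SA (u (lt x.2 y.2))),
        (* (ii) *)
        (forall h g, f' h g =
           \sum_(x <- delta4 DH h) \sum_(y <- delta4 DH g)
              u x.1.1.1 * rt x.1.1.2 (u y.1.1.1) * f (lt x.1.2 (u y.1.1.2)) y.1.2
                * SA (u (m' x.2 y.2))) &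
        (* (iii) *)
        (forall h g, m' h g = \sum_(y <- DH g) m (lt h (u y.1)) y.2)] in
  (forall Phi : A -> H -> seq (A * H),
     ext_morphism DA eA DH eH oneH (umul DA DH m' lt' rt' f') (umul DA DH m lt rt f) Phi ->
     (forall h a, lt' h a = lt h a) /\
     exists u : H -> A, conds u /\
       (forall a h, teq2 (Phi a h) (phi_of DH u a h)) /\
       lin_bijective Phi)
  /\
  (forall u : H -> A, (forall h a, lt' h a = lt h a) -> conds u ->
     ext_morphism DA eA DH eH oneH (umul DA DH m' lt' rt' f') (umul DA DH m lt rt f) (phi_of DH u)
     /\ lin_bijective (phi_of DH u)).
Proof.
move=> hA hE hE' conds; have cH := ext_coalgebra hE.
have lDA := @linear_comul _ _ _ _ (hopf_coalgebra hA).
have lDH := @linear_comul _ _ _ _ cH.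
have [l1 l2 l3 l4] := linear_umul hA hE.
split=> [Phi mPhi|u elt [hu ci cii ciii]].
- pose u := cocycle_of eH Phi.
  have hu : lazy_cocycle DA eA DH eH oneH u by exact: (lazy_cocycle_of hA hE mPhi).
  have ePhi a h : teq2 (Phi a h) (phi_of DH u a h) by exact: (ext_morphism_phi_of hE mPhi).
  have lu : linear u by case: hu => lu _ _ _ _; exact: lu.
  have u1 : u oneH = 1 by case: hu.
  have lphi (X : lmodType k) (b : A -> H -> X) :
      bilin b -> bilin (fun a h => ev b (phi_of DH u a h)).
    exact: (bilin_phi_of cH).
  have mult (X : lmodType k) (b : A -> H -> X) a h c g : bilin b ->
      \sw_(x, y <- umul DA DH m' lt' rt' f' a h c g) ev b (phi_of DH u x y) =
      \sw_(x, y <- phi_of DH u a h) \sw_(z, w <- phi_of DH u c g)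
         ev b (umul DA DH m lt rt f x y z w).
    move=> lb; case: mPhi => _ _ _ [/(_ a h c g X b lb) + _] _.
    rewrite mulT_seq1 -!/(ev b _) ev_applyT ev_mulT => E.
    etransitivity; last (etransitivity; first exact: E).
      by apply: eq_ev => x y; symmetry; exact: ePhi.
    have lb' (x : A) (y : H) : bilin (fun z w => ev b (umul DA DH m lt rt f x y z w)) by mlin.
    transitivity (\sw_(x, y <- Phi a h) \sw_(z, w <- phi_of DH u c g)
         ev b (umul DA DH m lt rt f x y z w)).
      by apply: eq_ev => x y; exact: ePhi.
    by apply: (ePhi a h); mlin.
  (* Multiplicativity at [g = oneH], where [phi (c >< 1) = c >< 1] because [u oneH = 1]. *)
  have right1 (X : lmodType k) (b : A -> H -> X) h c : bilin b ->
      \sw_(x, y <- umul DA DH m' lt' rt' f' 1 h c oneH) ev b (phi_of DH u x y) =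
      \sw_(x, y <- phi_of DH u 1 h) ev b (umul DA DH m lt rt f x y c oneH).
    move=> lb; rewrite mult //; apply: eq_ev => x y.
    by rewrite ev_phi_of (ext_comul_one hE) ?u1 ?mulr1 //; mlin.
  have [elt ci] := iffLR (phi_right1P hA hE hE' hu) right1.
  have [ciii cii] := iffLR (phi_left1P hA hE hE' hu) (fun X b h g => mult X b 1 h 1 g).
  split=> //; exists u; split; last by split=> //; exact: (lin_bijective_phi hA hE hu).
  split=> // h c; last by rewrite cii (conv_mulQ hA hE hE' hu).
  by rewrite ci -(conv_actQ hA hE hu); apply: eq_conv => // x y; rewrite elt.
- have lu : linear u by case: hu => lu _ _ _ _; exact: lu.
  have u1 : u oneH = 1 by case: hu.
  split; last exact: (lin_bijective_phi hA hE hu).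
  have right1 := iffRL (phi_right1P hA hE hE' hu).
  have left1 := iffRL (phi_left1P hA hE hE' hu).
  split.
  + by apply/bilin_intoP => X b; exact: (bilin_phi_of cH).
  + move=> b a h X c lc; rewrite -!/(ev c _) phi_of_mull.
    by rewrite (ev_map c (fun x _ => b * x) (fun _ y => y)).
  + move=> a h X b lb; rewrite !big_allpairs_dep.
    transitivity (\sw_(h1, h2 <- DH h) \sw_(x, y <- phi_of DH u a h1) b x y h2) => //.
    transitivity (\sw_(x, y <- phi_of DH u a h) \sw_(h1, h2 <- DH y) b x h1 h2) => //.
    (* For [phi] the comodule condition is plain coassociativity of [H]. *)
    rewrite ev_phi_of -(coassoc cH (F := fun h1 h2 h3 => b (a * u h1) h2 h3)); last by mlin.
    by apply: eq_ev => *; rewrite ev_phi_of.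
  + split=> [a h c g X b lb|X b lb]; rewrite -!/(ev b _).
      rewrite mulT_seq1 ev_applyT ev_mulT (phi_multiplicative hA hE hE' hu) //.
        apply: right1; split=> // x y.
        rewrite ci -(conv_actQ hA hE hu); apply: eq_conv => // p q.
        by rewrite elt.
      by apply: left1; split=> // x y; rewrite cii (conv_mulQ hA hE hE' hu).
    by rewrite ev_phi_of (ext_comul_one hE) ?u1 ?mulr1 ?ev_seq1 //; mlin.
  + split=> [a h X b lb|a h].
      rewrite sum_DT (phi_comul hA hE hu) // big_flatten big_map sum_DT ev_seq1.
      apply: eq_ev => a1 a2; apply: eq_ev => h1 h2; rewrite big_allpairs_dep.
      by [].
    have leA := linear_counit (hopf_coalgebra hA); have leH := linear_counit cH.
    rewrite -[LHS]/(ev (fun x y => eA x *: (eH y : k^o)) (phi_of DH u a h)) ev_phi_of.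
    rewrite -[RHS](counitr cH (g := fun h => eA a *: (eH h : k^o))); last by mlin.
    apply: (eq_ev (X := k^o)) => h1 h2; case: hu => _ _ eu _ _.
    rewrite (counit_mul hA) eu -[LHS]/(_ * _ * _) -[RHS]/(_ * (_ * _)).
    by rewrite mulrC.
Qed.
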